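(* Let $G$ be a finite group with $G\in\mathcal{D}_4$ and $G\not\cong\mathrm{A}_5$. Then $G$ is solvable, and either $G$ has derived length at most $2$ or $G\cong\mathrm{SL}_2(3)$.
   Context: $\mathcal{D}(G)$ denotes the number of conjugacy classes of nontrivial subgroups $H$ of the finite group $G$ with $N_G(H)\neq H$; $\mathcal{D}_n$ is the family of finite groups $G$ with $\mathcal{D}(G)=n$. *)

(* Defs.v *)
From HB Require Import structures.
From mathcomp Require Import all_boot all_order all_algebra all_fingroup all_solvable.
Set Implicit Arguments. Unset Strict Implicit. Unset Printing Implicit Defensive.
Import GroupScope GRing.Theory.

Definition nsn_subgroups (gT : finGroupType) (G : {set gT}) : {set {set gT}} :=
  [set H : {set gT} | [&& group_set H, H \subset G, H != 1 & 'N_G(H) != H]].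

Definition Dcount (gT : finGroupType) (G : {set gT}) : nat :=
  #|[set H :^: G | H in nsn_subgroups G]|.

Local Open Scope ring_scope.
Definition SL23 : {set {'GL_2['F_3]}} :=
  [set g : {'GL_2['F_3]} | \det (GLval g) == 1%R].

Local Close Scope ring_scope.
Definition A5 : {set {perm 'I_5}} := 'Alt_('I_5).

(* Main.v *)
Require Import Defs.
From mathcomp Require Import all_boot all_order all_algebra all_fingroup all_solvable.
From mathcomp Require Import vcharacter integral_char.
From mathcomp Require Import zify.
Set Implicit Arguments.
Unset Strict Implicit.
Unset Printing Implicit Defensive.
Import GroupScope FiniteModule.

(** Write "nsn" for a nontrivial subgroup that is not self-normalizing.  A
    p-subgroup that is not Sylow is nsn, and so is any proper nontrivial
    subnormal subgroup; four nsn subgroups of distinct orders therefore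
    account for all nsn subgroups up to conjugacy.

    If G is not solvable, Burnside's transfer and p^a q^b theorems leave only
    the nsn orders p, p^2, q, r with #|G| = p^a q r, where p is the least prime
    and a is 2 or 3.  Then Sylow q- and r-subgroups are self-centralizing of
    prime index in their normalizers, and counting elements forces a = 2 and
    p = 2, after which Sylow's theorem gives #|G| = 60; G acts faithfully on
    the five cosets of the normalizer of a Sylow 2-subgroup.

    If G is solvable, a composition series contains an nsn subgroup for every
    number of prime factors (with multiplicity) strictly between 0 and that of
    #|G|, so #|G| has at most five prime factors.  With five, the nsn subgroups
    with a given number of prime factors form one class, and G'' = 1.  With at
    most four and G'' nontrivial, either G'' is elementary abelian of rank 2,
    which is impossible, or G' is nonabelian of order s^3 and index p; the
    s + 1 subgroups of order s^2 in G' are then permuted by an element of order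
    p, which forces s = 2, p = 3 and the defining relations of SL_2(3). *)

(** * Burnside transfer *)

(** An exhausted list of nsn orders is used in two opposite ways. Nsn subgroups of equal order are
    conjugate, so a property of one (cyclic, central, inside a given normal subgroup) passes to all
    of that order. A nontrivial subgroup whose order is missing is self-normalizing; it then
    centralizes nothing nontrivial in a subgroup of coprime order, and fixed points can be counted
    modulo a prime. The delicate nonsolvable case is a = 3, where the Sylow p-subgroup is
    self-normalizing. Its subgroups of order p^2 are conjugate, hence all cyclic, which makes it a
    Frobenius complement, or all noncyclic, which gives it exponent p. Counting works for p > 2
    because Sylow q- and r-subgroups then have index at least 3 in their normalizers: their
    conjugates cover less than two thirds of G, and the p-elements must fill more than a quarter.
    SL_2(3) is recognized by relations, without a free presentation: two groups satisfying them are
    compared inside their direct product. *)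

(** Since [S] is abelian, [S] and [S :^ g] both centralize [x ^ g], and they are Sylow in its
    centralizer. Some [c] there carries the second to the first, so [g * c] normalizes, hence
    centralizes, [S]. *)
Lemma Sylow_fusion_cent (gT : finGroupType) (p : nat) (G S : {group gT}) x g :
    p.-Sylow(G) S -> 'N_G(S) \subset 'C(S) ->
  x \in S -> g \in G -> x ^ g \in S -> x ^ g = x.
Proof.
move=> sylS cNS Sx Gg Sxg; have sSG := pHall_sub sylS.
have cSS : abelian S by apply: subset_trans cNS; rewrite subsetI sSG normG.
have cS : S \subset 'C_G[x ^ g].
  by rewrite subsetI sSG; apply/subsetP=> y Sy; apply/cent1P; apply: (centsP cSS).
have cSg : S :^ g \subset 'C_G[x ^ g].
  rewrite subsetI conj_subG //=; apply/subsetP=> _ /imsetP[y Sy ->].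
  by apply/cent1P; rewrite /commute -!conjMg (centsP cSS y Sy x).
have sCG : 'C_G[x ^ g] \subset G := subsetIl _ _.
have sylS1 := pHall_subl cS sCG sylS.
have sylS2 : p.-Sylow('C_G[x ^ g]) (S :^ g).
  by apply: (pHall_subl cSg sCG); rewrite pHallJ.
have [c /setIP[Gc /cent1P cc] eqS] := Sylow_trans sylS2 sylS1.
have cgc : g * c \in 'C(S).
  apply: (subsetP cNS); rewrite inE groupM //=; apply/normP.
  by rewrite conjsgM -eqS.
have xgc : x ^ (g * c) = x by rewrite /conjg -(centP cgc x Sx) mulKg.
by rewrite -{2}xgc conjgM [(x ^ g) ^ c]/conjg -cc mulKg.
Qed.

(* The transfer into S maps each g in S to g ^+ #|G : S|, as fusion in S is trivial. *)
Theorem Burnside_normal_complement (gT : finGroupType) (p : nat) (G S : {group gT}) :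
    p.-Sylow(G) S -> 'N_G(S) \subset 'C(S) ->
  exists2 K : {group gT}, K <| G & p^'.-Hall(G) K.
Proof.
move=> sylS cNS; have [sSG pS _] := and3P sylS.
have cSS : abelian S by apply: subset_trans cNS; rewrite subsetI sSG normG.
have cA : abelian (idm S @* S) by rewrite morphim_idm.
pose tr := transfer_morphism G (alpha := idm_morphism S) cA.
pose K := 'ker tr; have nsKG : K <| G := ker_normal tr.
have tiKS : K :&: S = 1.
  apply/trivgP/subsetP=> g /setIP[Kg Sg]; have Gg := subsetP sSG g Sg.
  have := mker Kg; rewrite /tr /=.
  have partX := rcosets_cycle_partition sSG Gg.
  have trX := transversalP partX; set X := transversal _ _ in trX.
  have /and3P[_ sXG _] := trX.
  rewrite (transfer_cycle_expansion sSG cA Gg trX) => sum0.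
  have Ag : g \in idm S @* S by rewrite morphim_idm.
  suff : g ^+ #|G : S| = 1.
    move/eqP; rewrite -order_dvdn => dg; rewrite inE -order_eq1 -dvdn1.
    have := pnat_coprime pS (pnat_dvd (dvdnn _) _ : p^'.-nat #|G : S|).
    rewrite /coprime => /(_ _)/eqP<- //; last by case/and3P: sylS.
    by rewrite dvdn_gcd dg order_dvdG.
  suff e : fmod cA (g ^+ #|G : S|) = 1.
    by have := congr_fmod e; rewrite [fmval (fmod _ _)]fmodK // groupX.
  rewrite -[RHS]sum0 fmodX //.
  rewrite -(sum_index_rcosets_cycle sSG Gg trX) -GRing.sumrMnr.
  apply: eq_bigr => x Xx; rewrite -fmodX //= /restrm /=; congr fmod.
  (* The power of [g] by the length of its cycle through the coset [S :* x] fixes that coset. *)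
  have Sgx : (g ^+ #|<[g]> : S :* x|) ^ x^-1 \in S.
    rewrite conjgE invgK mulgA -mem_rcoset.
    exact: mulg_exp_card_rcosets.
  rewrite /idm (Sylow_fusion_cent sylS cNS _ _ Sgx) ?groupX //.
  by rewrite groupV (subsetP sXG).
exists K => //; rewrite /pHall normal_sub //.
have p'K : p^'.-group K.
  have := Sylow_setI_normal nsKG sylS; rewrite tiKS => /card_Hall.
  by rewrite cards1 => /esym/eqP; rewrite partG_eq1.
(* The quotient by the kernel is isomorphic to the image of the transfer, which embeds in [S]. *)
rewrite p'K -card_quotient ?normal_norm //=.
rewrite (card_isog (first_isog tr)) pnatNK.
have injf : 'injm (fmval_morphism cA) by apply/injmP=> u v _ _; exact: fmod_inj.
rewrite -(card_injm injf) ?subsetT //; apply: (pnat_dvd _ pS); apply: cardSg.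
apply/subsetP=> _ /morphimP[u _ _ ->].
by have : fmval u \in idm S @* S := fmodP u; rewrite morphim_idm.
Qed.

(** * Prime factors counted with multiplicity *)

(** [logn p n] is 0 unless p is prime, so the sum may run over all p up to n; [bigomega_widen]
    brings two such sums to a common range, where they add termwise. *)
Definition bigomega (n : nat) : nat := \sum_(p < n.+1) logn p n.

Lemma bigomega_widen (m n : nat) :
  0 < n <= m -> bigomega n = \sum_(p < m.+1) logn p n.
Proof.
case/andP=> n_gt0 le_nm; rewrite /bigomega.
rewrite (big_ord_widen m.+1 (fun p => logn p n)) ?ltnS // big_mkcond /=.
apply: eq_bigr => p _; case: ifP => // /negbT; rewrite -leqNgt => lt_np.
by rewrite ltn_log0.
Qed.

Lemma bigomegaM (m n : nat) :
  0 < m -> 0 < n -> bigomega (m * n) = (bigomega m + bigomega n)%N.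
Proof.
move=> m_gt0 n_gt0; rewrite (@bigomega_widen (m * n) m) ?(@bigomega_widen (m * n) n).
- by rewrite /bigomega -big_split /=; apply: eq_bigr => p _; rewrite lognM.
- by rewrite n_gt0 leq_pmull.
by rewrite m_gt0 leq_pmulr.
Qed.

Lemma bigomega1 : bigomega 1 = 0.
Proof. by rewrite /bigomega big1 // => p _; rewrite logn1. Qed.

Lemma bigomega_prime (p : nat) : prime p -> bigomega p = 1%N.
Proof.
move=> p_pr; rewrite /bigomega (bigD1 ord_max) //= logn_prime // eqxx big1 ?addn0 //.
by move=> i ne_ip; rewrite logn_prime // -val_eqE /= in ne_ip *; rewrite (negPf ne_ip).
Qed.

Lemma bigomega_gt0 (n : nat) : 1 < n -> 0 < bigomega n.
Proof.
move=> n_gt1; rewrite -(divnK (pdiv_dvd n)) bigomegaM ?pdiv_gt0 //.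
  by rewrite (bigomega_prime (pdiv_prime n_gt1)) addn1.
by rewrite divn_gt0 ?pdiv_gt0 // dvdn_leq ?pdiv_dvd // ltnW.
Qed.

Lemma bigomega_eq1 (n : nat) : 0 < n -> bigomega n = 1%N -> prime n.
Proof.
move=> n_gt0 om1; have n_gt1 : 1 < n by case: n n_gt0 om1 => [|[|]] //; rewrite bigomega1.
have p_pr := pdiv_prime n_gt1.
have m_gt0 : 0 < n %/ pdiv n by rewrite divn_gt0 ?pdiv_gt0 // dvdn_leq ?pdiv_dvd.
move: om1; rewrite -{1}(divnK (pdiv_dvd n)) bigomegaM ?pdiv_gt0 //.
rewrite (bigomega_prime p_pr) => /eqP; rewrite addn1 eqSS => om0.
suff m1 : n %/ pdiv n = 1%N by rewrite -(divnK (pdiv_dvd n)) m1 mul1n.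
case: (ltngtP (n %/ pdiv n) 1) => // [|/bigomega_gt0]; first by rewrite ltnS leqNgt m_gt0.
by rewrite (eqP om0).
Qed.

Lemma bigomega_eq2 (n : nat) :
  0 < n -> bigomega n = 2 -> exists p q, [/\ prime p, prime q & n = (p * q)%N].
Proof.
move=> n_gt0 om2; have n_gt1 : 1 < n by case: n n_gt0 om2 => [|[|]] //; rewrite bigomega1.
have m_gt0 : 0 < n %/ pdiv n by rewrite divn_gt0 ?pdiv_gt0 // dvdn_leq ?pdiv_dvd.
exists (pdiv n), (n %/ pdiv n); split; first exact: pdiv_prime.
  apply: bigomega_eq1 => //; move: om2.
  rewrite -{1}(divnK (pdiv_dvd n)) bigomegaM ?pdiv_gt0 //.
  by rewrite (bigomega_prime (pdiv_prime n_gt1)) addn1 => -[].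
by rewrite mulnC divnK ?pdiv_dvd.
Qed.

(** * Non-self-normalizing subgroups *)

Section NonSelfNormalizing.

Variable gT : finGroupType.
Implicit Types G H K X : {group gT}.

Lemma nsnE G H :
  (gval H \in nsn_subgroups G) = [&& H \subset G, H :!=: 1 & 'N_G(H) != H].
Proof. by rewrite inE groupP. Qed.

Lemma nsn_normal G H K :
  H <| K -> K \subset G -> H :!=: 1 -> H :!=: K -> gval H \in nsn_subgroups G.
Proof.
move=> /andP[sHK nHK] sKG ntH neqHK; rewrite nsnE (subset_trans sHK) // ntH /=.
apply: contra neqHK => /eqP defN; rewrite eqEsubset sHK /=.
have sKN : K \subset 'N_G(H) by rewrite subsetI sKG.
by rewrite defN in sKN.
Qed.

Definition nsn_order G (n : nat) : bool :=
  [exists H : {group gT}, (gval H \in nsn_subgroups G) && (#|H| == n)].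

Lemma nsn_orderP G n :
  reflect (exists2 H : {group gT}, gval H \in nsn_subgroups G & #|H| = n)
          (nsn_order G n).
Proof.
apply: (iffP existsP) => [[H /andP[? /eqP]]|[H ? /eqP ?]]; exists H => //.
exact/andP.
Qed.

(** The common order of the members of a conjugacy class; 0 is a default for the empty set, which is
    never a class. *)
Definition class_order (C : {set {set gT}}) : nat :=
  if [pick A in C] is Some A then #|A| else 0.

Lemma class_orderE G (H : {set gT}) : class_order (H :^: G) = #|H|.
Proof.
rewrite /class_order; case: pickP => [_ /imsetP[x _ ->]|/(_ H)]; first exact: cardJg.
by rewrite (orbit_refl 'Js).
Qed.

(** Pigeonhole: the orders attached to the [Dcount G] classes include [l]. If [l] is at least as
    long as the number of classes, no other order fits and [class_order] is injective on classes,
    which is the conjugacy statement. *)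
Lemma nsn_order_exhaust G (l : seq nat) :
    uniq l -> all (nsn_order G) l -> Dcount G <= size l ->
  [/\ size l = Dcount G,
      forall H, gval H \in nsn_subgroups G -> #|H| \in l
    & forall H K, gval H \in nsn_subgroups G -> gval K \in nsn_subgroups G ->
        #|H| = #|K| -> exists2 x, x \in G & K :=: H :^ x].
Proof.
move=> uniq_l /allP all_l le_l; pose Cl := [set H :^: G | H in nsn_subgroups G].
pose l' := [seq class_order C | C <- enum Cl].
have sz_l' : size l' = Dcount G by rewrite size_map -cardE.
have memCl H : gval H \in nsn_subgroups G -> (H :^: G) \in Cl by apply: imset_f.
have meml' H : gval H \in nsn_subgroups G -> #|H| \in l'.
  move=> nH; apply/mapP; exists (H :^: G); rewrite ?class_orderE //.
  by rewrite mem_enum memCl.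
have sub_l : {subset l <= l'}.
  by move=> n /all_l/nsn_orderP[H nH <-]; apply: meml'.
have le_l' : size l' <= size l by rewrite sz_l'.
have [eq_sz eq_l] := uniq_min_size uniq_l sub_l le_l'.
have uniq_l' := leq_size_uniq uniq_l sub_l le_l'.
split=> [|H nH|H K nH nK eqHK]; rewrite ?eq_l ?meml' //; first by rewrite eq_sz.
have injCl : {in Cl &, injective class_order} by apply/dinjectiveP.
have eqC : H :^: G = K :^: G by apply: injCl; rewrite ?memCl // !class_orderE.
have: gval K \in K :^: G by rewrite (orbit_refl 'Js).
by rewrite -eqC => /imsetP.
Qed.

Lemma size_leq_Dcount G (l : seq nat) :
  uniq l -> all (nsn_order G) l -> size l <= Dcount G.
Proof.
move=> uniq_l all_l; rewrite leqNgt; apply/negP=> lt_l.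
by have [eq_sz _ _] := nsn_order_exhaust uniq_l all_l (ltnW lt_l); rewrite eq_sz ltnn in lt_l.
Qed.

(** [X] is proper in a Sylow subgroup [P], and normalizers grow in the nilpotent group [P]. *)
Lemma nsn_not_Sylow G X (p : nat) :
  p.-group X -> X :!=: 1 -> X \subset G -> ~~ p.-Sylow(G) X ->
  gval X \in nsn_subgroups G.
Proof.
move=> pX ntX sXG nsylX; have [P sylP sXP] := Sylow_superset sXG pX.
have [pP sPG] := (pHall_pgroup sylP, pHall_sub sylP).
have prXP : X \proper P.
  rewrite properEneq sXP andbT; apply: contraNneq nsylX => eqXP.
  by rewrite (group_inj eqXP).
have := nilpotent_proper_norm (pgroup_nil pP) prXP => prN.
apply: (@nsn_normal _ _ 'N_P(X)) => //.
- by rewrite normal_subnorm.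
- by rewrite subIset ?sPG.
exact: proper_neq.
Qed.

(** If [X] is Sylow in [G], it is Sylow in [K], and the Frattini argument gives G = K N_G(X); a
    self-normalizing [X] would make [G] equal to [K]. *)
Lemma nsn_normal_complement G K X (p q : nat) :
    K <| G -> p^'.-Hall(G) K -> K :!=: G -> q != p ->
    q.-group X -> X :!=: 1 -> X \subset G ->
  gval X \in nsn_subgroups G.
Proof.
move=> nsKG hallK neqKG neqpq qX ntX sXG.
have [sylX|nsylX] := boolP (q.-Sylow(G) X); last exact: nsn_not_Sylow nsylX.
have sXK : X \subset K.
  rewrite (sub_normal_Hall hallK) //; apply: sub_pgroup qX => r /eqnP->.
  by rewrite !inE.
have sylXK := pHall_subl sXK (normal_sub nsKG) sylX.
have defG := Frattini_arg nsKG sylXK.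
rewrite nsnE sXG ntX /=; apply: contra neqKG => /eqP defN.
by rewrite -defG defN mulGSid.
Qed.

Lemma subgroup_of_order G (p k : nat) :
  prime p -> p ^ k %| #|G| -> exists2 X : {group gT}, X \subset G & #|X| = (p ^ k)%N.
Proof.
move=> p_pr dv; have [P sylP] := Sylow_exists p G.
have lek : k <= logn p #|P|.
  by rewrite (card_Hall sylP) p_part pfactorK // -pfactor_dvdn.
have [X [sXP _ oX]] := normal_pgroup (pHall_pgroup sylP) (normal_refl P) lek.
by exists X => //; apply: subset_trans (pHall_sub sylP).
Qed.

Lemma ntriv_ppow X (p k : nat) : prime p -> 0 < k -> #|X| = (p ^ k)%N -> p.-group X /\ X :!=: 1.
Proof.
move=> p_pr k_gt0 oX; split; first by rewrite /pgroup oX pnatX pnat_id.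
by rewrite -cardG_gt1 oX -(exp1n k) ltn_exp2r // prime_gt1.
Qed.

Lemma nsn_order_not_Sylow G (p k : nat) :
  prime p -> 0 < k -> p ^ k.+1 %| #|G| -> nsn_order G (p ^ k).
Proof.
move=> p_pr k_gt0 dv.
have [X sXG oX] : exists2 X : {group gT}, X \subset G & #|X| = (p ^ k)%N.
  by apply: subgroup_of_order => //; apply: dvdn_trans dv; rewrite dvdn_exp2l.
have [pX ntX] := ntriv_ppow p_pr k_gt0 oX.
apply/nsn_orderP; exists X => //; apply: nsn_not_Sylow pX ntX sXG _.
apply/negP=> /card_Hall; rewrite oX p_part => /eqP.
rewrite eqn_exp2l ?prime_gt1 // => /eqP eqk.
by move: dv; rewrite pfactor_dvdn // -eqk ltnn.
Qed.

Lemma nsn_order_normal_complement G K (p q k : nat) :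
    K <| G -> p^'.-Hall(G) K -> K :!=: G -> prime q -> q != p ->
  0 < k -> q ^ k %| #|G| -> nsn_order G (q ^ k).
Proof.
move=> nsKG hallK neqKG q_pr neqpq k_gt0 dv.
have [X sXG oX] := subgroup_of_order q_pr dv.
have [qX ntX] := ntriv_ppow q_pr k_gt0 oX.
by apply/nsn_orderP; exists X => //; apply: (nsn_normal_complement nsKG hallK neqKG neqpq).
Qed.

(** Each descent to a normal subgroup of prime index lowers [bigomega] by exactly one, so no value
    is skipped. *)
Lemma sol_normal_bigomega G i :
    solvable G -> i < bigomega #|G| ->
  exists H K : {group gT},
    [/\ H <| K, K \subset G, prime #|K : H| & bigomega #|H| = i].
Proof.
elim: {G}_.+1 {-2}G (ltnSn #|G|) => // n IHn G; rewrite ltnS => leGn solG lti.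
have ntG : G :!=: 1 by apply: contraTneq lti => ->; rewrite cards1 bigomega1.
have [M nsMG prM] := sol_prime_factor_exists solG ntG.
have sMG := normal_sub nsMG.
have omG : bigomega #|G| = (bigomega #|M|).+1.
  by rewrite -(Lagrange sMG) bigomegaM // (bigomega_prime prM) addn1.
move: lti; rewrite omG ltnS leq_eqVlt => /predU1P[->|lti]; first by exists M, G.
have ltM : #|M| < n.
  apply: leq_trans leGn; rewrite -(Lagrange sMG) ltn_Pmulr ?prime_gt1 //.
have [H [K [nsHK sKM prH omH]]] := IHn M ltM (solvableS sMG solG) lti.
by exists H, K; split=> //; apply: subset_trans sMG.
Qed.

Lemma sol_nsn_bigomega G i :
    solvable G -> 0 < i < bigomega #|G| ->
  exists2 n, nsn_order G n & bigomega n = i.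
Proof.
move=> solG /andP[i_gt0 lti].
have [H [K [nsHK sKG prH omH]]] := sol_normal_bigomega solG lti.
exists #|H| => //; apply/nsn_orderP; exists H => //; apply: nsn_normal nsHK sKG _ _.
  by apply: contraTneq i_gt0 => H1; rewrite -omH H1 cards1 bigomega1.
by apply: contraTneq prH => ->; rewrite indexgg.
Qed.

End NonSelfNormalizing.

(** * Nonsolvable groups *)

(** N/C embeds in the automorphism group of [S], of order [#|S|.-1] because [S] is cyclic of prime
    order. *)
Lemma index_norm_cent_prime (gT : finGroupType) (G S : {group gT}) :
  prime #|S| -> #|'N_G(S) : 'C_G(S)| %| #|S|.-1.
Proof.
move=> prS; have := card_morphim (conj_aut S) 'N_G(S).
rewrite /= ker_conj_aut => oA; have cyS := prime_cyclic prS.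
rewrite -totient_prime // -card_Aut_cyclic //.
have sA : conj_aut S @* 'N_G(S) \subset Aut S.
  by apply/subsetP=> _ /morphimP[x _ _ ->]; apply: Aut_aut.
have -> : #|'N_G(S) : 'C_G(S)| = #|conj_aut S @* 'N_G(S)|.
  rewrite oA (setIidPr (subsetIr _ _)) -[RHS]indexgI; congr #|_ : _|.
  by rewrite -setIA (setIidPr (cent_sub S)).
exact: cardSg.
Qed.

(** For a Sylow subgroup of order p, the index |N : C| divides both p - 1 and [#|G|]. As p is the
    least prime divisor of [#|G|], the index is 1 and transfer applies. *)
Lemma pdiv_normal_complement (gT : finGroupType) (G : {group gT}) (p := pdiv #|G|) :
    1 < #|G| -> ~~ (p ^ 2 %| #|G|) ->
  exists2 K : {group gT}, K <| G & p^'.-Hall(G) K.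
Proof.
move=> G_gt1 np2; have p_pr : prime p := pdiv_prime G_gt1.
have [S sylS] := Sylow_exists p G.
have oS : #|S| = p.
  rewrite (card_Hall sylS) p_part; suff -> : logn p #|G| = 1%N by [].
  apply/eqP; rewrite eqn_leq logn_gt0 mem_primes p_pr pdiv_dvd cardG_gt0 /=.
  by rewrite andbT leqNgt -pfactor_dvdn.
apply: (Burnside_normal_complement sylS).
have dvN := index_norm_cent_prime G (_ : prime #|S|); rewrite oS in dvN.
have sCN : 'C_G(S) \subset 'N_G(S) by rewrite setIS ?cent_sub.
have [i1|i_gt1] := eqVneq #|'N_G(S) : 'C_G(S)| 1%N.
  by move/eqP: i1; rewrite indexg_eq1 subsetI => /andP[].
have {}i_gt1 : 1 < #|'N_G(S) : 'C_G(S)| by rewrite ltn_neqAle eq_sym i_gt1 indexg_gt0.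
have dvG : pdiv #|'N_G(S) : 'C_G(S)| %| #|G|.
  apply: dvdn_trans (pdiv_dvd _) _; apply: dvdn_trans (dvdn_indexg _ _) _.
  by rewrite cardSg ?subsetIl.
have le1 := pdiv_min_dvd (prime_gt1 (pdiv_prime i_gt1)) dvG.
have le2 : pdiv #|'N_G(S) : 'C_G(S)| <= p.-1.
  apply: dvdn_leq; first by rewrite -subn1 subn_gt0 prime_gt1.
  by apply: dvdn_trans (pdiv_dvd _) (dvN p_pr).
have := prime_gt0 p_pr; rewrite -/p in le1; lia.
Qed.

Lemma Hall_compl_sol (gT : finGroupType) (p : nat) (G K : {group gT}) :
  K <| G -> p^'.-Hall(G) K -> solvable K -> solvable G.
Proof.
move=> nsKG hallK solK; rewrite (series_sol nsKG) solK /=.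
apply: (@pgroup_sol _ p); rewrite /pgroup card_quotient ?normal_norm //.
by case/and3P: hallK; rewrite pnatNK.
Qed.

(** The last clause supplies a fourth prime-power order. If p^2 does not divide [#|G|], the normal
    p-complement is again nonsolvable and brings three primes other than p. *)
Lemma nonsol_primes (gT : finGroupType) (G : {group gT}) (p := pdiv #|G|) :
  ~~ solvable G ->
  exists q r, [/\ uniq [:: p; q; r], all (mem (primes #|G|)) [:: p; q; r]
    & p ^ 2 %| #|G| \/ exists2 x, x \in primes #|G| & x \notin [:: p; q; r]].
Proof.
move=> nsG; have sz3 (H : {group gT}) : ~~ solvable H -> 2 < size (primes #|H|).
  by move=> nsH; rewrite ltnNge; apply: contra nsH; apply: Burnside_p_a_q_b.
have G_gt1 : 1 < #|G|.
  by rewrite cardG_gt1; apply: contraNneq nsG => ->; rewrite solvable1.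
have p_pr : prime p := pdiv_prime G_gt1.
have p_in : p \in primes #|G| by rewrite mem_primes p_pr cardG_gt0 pdiv_dvd.
have [p2|np2] := boolP (p ^ 2 %| #|G|).
  have := sz3 G nsG; have := primes_uniq #|G|; rewrite /p /pdiv.
  case: (primes #|G|) => [|a [|b [|c l]]] //= uniq_l _; exists b, c.
  rewrite !inE !eqxx !orbT; split=> //; last by left.
  move: uniq_l; rewrite !inE !negb_or; case/andP=> /and3P[-> -> _] /=.
  by case/andP=> /andP[->].
have [K nsKG hallK] := pdiv_normal_complement G_gt1 np2.
have nsK : ~~ solvable K by apply: contra nsG; apply: Hall_compl_sol hallK.
have sKG x : x \in primes #|K| -> (x \in primes #|G|) && (p != x).
  rewrite !mem_primes => /and3P[-> _ dvx]; rewrite cardG_gt0 /=.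
  rewrite (dvdn_trans dvx) ?cardSg ?normal_sub //=; apply: contraL dvx => /eqP<-.
  by have /and3P[_ p'K _] := hallK; rewrite -p'natE.
have := sz3 K nsK; have := primes_uniq #|K|.
case: (primes #|K|) sKG => [|a [|b [|c l]]] //= sKG uniq_l _; exists a, b.
have [/sKG/andP[aG pa] /sKG/andP[bG pb] /sKG/andP[cG pc]] : [/\ a \in [:: a, b, c & l],
  b \in [:: a, b, c & l] & c \in [:: a, b, c & l]] by rewrite !inE !eqxx !orbT.
move: uniq_l; rewrite !inE !negb_or aG bG p_in pa pb /= andbT.
case/andP=> /and3P[ab ac _] /andP[/andP[bc _] _]; split=> //.
right; exists c => //; rewrite !inE !negb_or.
by rewrite (eq_sym c p) (eq_sym c a) (eq_sym c b) pc ac bc.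
Qed.

Lemma two_primes_not_ppow (a b n u k : nat) :
  prime a -> prime b -> a != b -> a %| n -> b %| n -> prime u -> n != (u ^ k)%N.
Proof.
move=> a_pr b_pr neq_ab an bn u_pr; apply: contra neq_ab => /eqP eqn.
move: an bn; rewrite eqn !Euclid_dvdX // => /andP[+ _] /andP[+ _].
by rewrite !dvdn_prime2 // => /eqP-> /eqP->.
Qed.

Section NonsolvableFour.

Variables (gT : finGroupType) (G : {group gT}).
Hypotheses (D4 : Dcount G = 4) (nsG : ~~ solvable G).

(** By Frattini, the nontrivial primary subgroups of a proper [K] are nsn in [G]. [nonsol_primes]
    applied to [K] gives four such orders, and [#|K|], which is not a prime power, is a fifth. *)
Lemma nonsol_no_normal_complement (p : nat) (K : {group gT}) :
  K <| G -> p^'.-Hall(G) K -> K :=: G.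
Proof.
move=> nsKG hallK; apply/eqP; apply: contraT => neqKG.
have nsK : ~~ solvable K by apply: contra nsG; apply: Hall_compl_sol hallK.
have ntK : K :!=: 1 by apply: contraNneq nsK => ->; rewrite solvable1.
have nK : nsn_order G #|K|.
  by apply/nsn_orderP; exists K => //; apply: nsn_normal nsKG _ ntK neqKG.
have nX x k : 0 < k -> prime x -> x ^ k %| #|K| -> nsn_order G (x ^ k).
  move=> k_gt0 x_pr dvx.
  apply: (nsn_order_normal_complement nsKG hallK neqKG) => //.
    have /and3P[_ p'K _] := hallK; apply: contraTneq dvx => ex.
    rewrite ex in x_pr *; move: p'K; rewrite /pgroup p'natE //; apply: contra.
    by apply: dvdn_trans; rewrite dvdn_exp.
  by rewrite (dvdn_trans dvx) ?cardSg ?normal_sub.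
have [q [r []]] := nonsol_primes nsK; set p1 := pdiv _.
rewrite /= !inE !negb_or !andbT => /andP[/andP[p1q p1r] qr].
rewrite !mem_primes cardG_gt0 /= => /and3P[/andP[p1_pr dp1] /andP[q_pr dq] /andP[r_pr dr]].
have Kneq u k : prime u -> #|K| != (u ^ k)%N.
  exact: (two_primes_not_ppow _ p1_pr q_pr).
move=> p2x; suff: exists2 m, nsn_order G m & m \notin [:: #|K|; p1; q; r]; first case=> m nm' nm.
  have /= := @size_leq_Dcount _ G [:: m; #|K|; p1; q; r].
  rewrite D4 => H; suff : 4 < 4 by []; apply: H.
    rewrite /= nm !inE !negb_or p1q p1r qr -(expn1 p1) -(expn1 q) -(expn1 r) !Kneq //.
  by rewrite nm' nK -(expn1 p1) -(expn1 q) -(expn1 r) !nX // expn1.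
case: p2x => [p2|[x]].
  exists (p1 ^ 2)%N; first exact: nX.
  rewrite !inE !negb_or eq_sym Kneq //=; apply/and3P; split.
  + by rewrite -{2}(expn1 p1) eqn_exp2l ?prime_gt1.
  + by apply: contraNneq p1q => e; rewrite -dvdn_prime2 // -e dvdn_exp.
  + by apply: contraNneq p1r => e; rewrite -dvdn_prime2 // -e dvdn_exp.
rewrite mem_primes cardG_gt0 => /and3P[x_pr _ dx] nx.
exists x; first by rewrite -(expn1 x) nX // expn1.
by rewrite inE negb_or nx andbT -(expn1 x) eq_sym Kneq.
Qed.

End NonsolvableFour.

(** * Normalizers and conjugates of nsn subgroups *)

Lemma leq_card_class_support (gT : finGroupType) (A : {set gT}) (G : {group gT}) :
  #|class_support A G| <= #|A| * #|G : 'N_G(A)|.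
Proof.
rewrite class_supportEr -cover_imset; apply: leq_trans (leq_card_cover _) _.
rewrite -card_conjugates mulnC -sum_nat_const; apply: leq_sum => _ /imsetP[x _ ->].
by rewrite cardJg.
Qed.

Lemma sol_index_norm (gT : finGroupType) (G X : {group gT}) (m : nat) :
    0 < m -> #|G| = (#|X| * m)%N -> size (primes m) <= 2 -> X \subset G ->
  solvable ('N_G(X) / X).
Proof.
move=> m_gt0 oG szm sXG; apply: Burnside_p_a_q_b.
have sXN : X \subset 'N_G(X) by rewrite subsetI sXG normG.
rewrite card_quotient ?subsetIr //; apply: leq_trans szm.
apply: uniq_leq_size (primes_uniq _) _ => x.
rewrite !mem_primes m_gt0 => /and3P[-> _ dvx] /=.
apply: dvdn_trans dvx _; rewrite -(@dvdn_pmul2l #|X|) // -oG Lagrange //.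
by rewrite cardSg ?subsetIl.
Qed.

(** A normal subgroup of prime index in N_G(X)/X lifts to some [M] normal in N_G(X). It would be an
    nsn subgroup containing [X], so maximality makes it [X]. *)
Lemma prime_index_norm (gT : finGroupType) (G X : {group gT}) :
    gval X \in nsn_subgroups G -> solvable ('N_G(X) / X) ->
    (forall H : {group gT}, gval H \in nsn_subgroups G -> X \subset H -> #|H| = #|X|) ->
  prime #|'N_G(X) : X|.
Proof.
rewrite nsnE => /and3P[sXG ntX neqXN] solNX maxX.
have nsXN : X <| 'N_G(X) by rewrite normal_subnorm.
have ntNX : 'N_G(X) / X != 1.
  apply: contra neqXN => /eqP NX1; rewrite eqEsubset (normal_sub nsXN) andbT.
  by rewrite -quotient_sub1 ?subsetIr // NX1.
have [Mb nsMb prMb] := sol_prime_factor_exists solNX ntNX.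
have [M defMb sXM nsMN] := inv_quotientN nsXN nsMb.
have eqMX : M :=: X.
  apply/eqP; rewrite eq_sym eqEcard sXM maxX ?leqnn //=.
  apply: nsn_normal nsMN (subsetIl _ _) _ _.
    by apply: contra ntX => /eqP M1; rewrite -subG1 -M1.
  by apply: contraTneq prMb => eqMN; rewrite defMb eqMN indexgg.
move: prMb; rewrite defMb eqMX trivg_quotient indexg1 card_quotient //.
exact: subsetIr.
Qed.

Lemma expn_neq_prime (x y k : nat) : prime x -> prime y -> 1 < k -> (x ^ k)%N != y.
Proof.
move=> x_pr y_pr k_gt1; apply/eqP=> eq_xy; rewrite -eq_xy in y_pr.
have := dvdn_prime2 x_pr y_pr; rewrite dvdn_exp ?(ltnW k_gt1) // => /esym.
by rewrite -[X in X == _]expn1 eqn_exp2l ?prime_gt1 // ltn_eqF.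
Qed.

Section NonsolvableFour.

Variables (gT : finGroupType) (G : {group gT}).
Hypotheses (D4 : Dcount G = 4) (nsG : ~~ solvable G).

Lemma nonsol_norm_cent_Sylow (p : nat) (P : {group gT}) :
  p.-Sylow(G) P -> P :!=: 1 -> ~~ ('N_G(P) \subset 'C(P)).
Proof.
move=> sylP ntP; apply/negP=> cN.
have [K nsKG hallK] := Burnside_normal_complement sylP cN.
have eqKG := nonsol_no_normal_complement D4 nsG nsKG hallK.
case/negP: ntP; have [sPG pP _] := and3P sylP; have [_ p'K _] := and3P hallK.
rewrite -(setIidPl sPG) -eqKG; apply/eqP; apply: coprime_TIg.
exact: pnat_coprime pP p'K.
Qed.

Lemma nonsol_Sylow_nsn (p : nat) (P : {group gT}) :
  p.-Sylow(G) P -> P :!=: 1 -> abelian P -> gval P \in nsn_subgroups G.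
Proof.
move=> sylP ntP cPP; rewrite nsnE (pHall_sub sylP) ntP /=.
by apply: contra (nonsol_norm_cent_Sylow sylP ntP) => /eqP->.
Qed.

(** Either the subgroup is not Sylow, or it is an abelian Sylow subgroup, which transfer prevents
    from being self-normalizing. *)
Lemma nonsol_nsn_order (p k : nat) :
  prime p -> 0 < k <= 2 -> p ^ k %| #|G| -> nsn_order G (p ^ k).
Proof.
move=> p_pr /andP[k_gt0 le_k2] dv.
have [dvS|ndvS] := boolP (p ^ k.+1 %| #|G|); first exact: nsn_order_not_Sylow.
have [X sXG oX] := subgroup_of_order p_pr dv.
have [pX ntX] := ntriv_ppow p_pr k_gt0 oX.
apply/nsn_orderP; exists X => //; apply: (@nonsol_Sylow_nsn p) => //.
  rewrite pHallE sXG oX p_part eqn_exp2l ?prime_gt1 // eqn_leq.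
  by rewrite -pfactor_dvdn // dv leqNgt -pfactor_dvdn.
by apply: (p2group_abelian pX); rewrite oX pfactorK.
Qed.

Lemma nonsol_structure : exists p q r a : nat,
  [/\ [/\ prime p, prime q & prime r], [/\ p < q, p < r & q != r],
      2 <= a <= 3, #|G| = (p ^ a * q * r)%N
    & (forall H : {group gT}, gval H \in nsn_subgroups G -> #|H| \in [:: p; p ^ 2; q; r]%N)
    /\ (forall H K : {group gT}, gval H \in nsn_subgroups G -> gval K \in nsn_subgroups G ->
        #|H| = #|K| -> exists2 x, x \in G & K :=: H :^ x)].
Proof.
have G_gt1 : 1 < #|G|.
  by rewrite cardG_gt1; apply: contraNneq nsG => ->; rewrite solvable1.
have [q [r []]] := nonsol_primes nsG; set p := pdiv _.
rewrite /= !inE !negb_or !andbT => /andP[/andP[pq pr] qr].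
rewrite !mem_primes cardG_gt0 /= => /and3P[/andP[p_pr dp] /andP[q_pr dq] /andP[r_pr dr]] _.
have p2G : p ^ 2 %| #|G|.
  apply: contraT => np2; have [K nsKG hallK] := pdiv_normal_complement G_gt1 np2.
  have eqKG := nonsol_no_normal_complement D4 nsG nsKG hallK.
  have /and3P[_ + _] := hallK.
  by rewrite eqKG /pgroup p'natE ?pdiv_dvd.
have n1 x : prime x -> x %| #|G| -> nsn_order G x.
  by move=> x_pr dx; rewrite -(expn1 x) nonsol_nsn_order ?expn1.
have sq_neq x y : prime x -> prime y -> (x ^ 2)%N != y.
  by move=> x_pr y_pr; apply: expn_neq_prime.
have uniq_l : uniq [:: p; p ^ 2; q; r]%N.
  by rewrite /= !inE !negb_or pq pr qr !sq_neq // eq_sym sq_neq.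
have all_l : all (nsn_order G) [:: p; p ^ 2; q; r]%N.
  by rewrite /= (nonsol_nsn_order p_pr _ p2G) // !n1.
have [_ nsn_in nsn_conj] := nsn_order_exhaust uniq_l all_l (eq_leq D4).
have in_l n : nsn_order G n -> n \in [:: p; p ^ 2; q; r]%N.
  by case/nsn_orderP=> H nH <-; apply: nsn_in.
(* x^2 would be an nsn order, and the only square of a prime on the list is p^2. *)
have sq1 x : prime x -> x ^ 2 %| #|G| -> x = p.
  move=> x_pr dx; have /in_l := @nonsol_nsn_order x 2 x_pr isT dx.
  rewrite !inE (negPf (sq_neq x p _ _)) // (negPf (sq_neq x q _ _)) //.
  rewrite (negPf (sq_neq x r _ _)) // !orbF /= => /eqP/(congr1 pdiv).
  by rewrite !pdiv_pfactor.
have logn1 x : prime x -> x %| #|G| -> x != p -> logn x #|G| = 1%N.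
  move=> x_pr dx neqx.
  have lt2 : logn x #|G| < 2.
    rewrite ltnNge -pfactor_dvdn //; apply/negP => /(sq1 _ x_pr) eqx.
    by rewrite eqx eqxx in neqx.
  have gt0 : 0 < logn x #|G| by rewrite logn_gt0 mem_primes x_pr cardG_gt0.
  lia.
have perm_pr : perm_eq (primes #|G|) [:: p; q; r].
  apply: uniq_perm; rewrite ?primes_uniq //= ?inE ?negb_or ?pq ?pr ?qr // => x.
  rewrite mem_primes cardG_gt0 /= !inE; apply/idP/idP.
    case/andP=> x_pr dx; have := in_l _ (n1 x x_pr dx).
    by rewrite !inE (eq_sym x (p ^ 2)%N) (negPf (sq_neq _ _ _ _)).
  by case/or3P=> /eqP->; rewrite ?p_pr ?q_pr ?r_pr.
exists p, q, r, (logn p #|G|); split=> //.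
- by split=> //; rewrite ltn_neqAle ?pq ?pr pdiv_min_dvd ?prime_gt1.
(* If p^4 divided the order, p^3 would be a fifth nsn order. *)
- rewrite -pfactor_dvdn // p2G leqNgt -pfactor_dvdn //=.
  apply/negP=> /(@nsn_order_not_Sylow _ G p 3 p_pr isT)/in_l; rewrite !inE.
  rewrite -{2}(expn1 p) !eqn_exp2l ?prime_gt1 //=.
  by rewrite !(negPf (expn_neq_prime _ _ _)).
rewrite {1}(prod_prime_decomp (cardG_gt0 G)) prime_decompE big_map /=.
rewrite (perm_big _ perm_pr) !big_cons big_nil /= muln1 mulnA.
by rewrite (logn1 q) ?(logn1 r) // eq_sym.
Qed.

End NonsolvableFour.

Lemma card_cent_mod (gT : finGroupType) (p : nat) (Y P : {group gT}) :
  p.-group Y -> Y \subset 'N(P) -> #|P| = #|'C_P(Y)| %[mod p].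
Proof. by move=> pY nPY; rewrite (pgroup_fix_mod pY (_ : [acts Y, on P | 'J])) ?afixJ ?astabsJ. Qed.

Lemma dvd_ppow2 (p a q r x : nat) :
    prime p -> prime q -> prime r -> prime x -> x %| p ^ a * q * r ->
  x \in [:: p; q; r].
Proof.
move=> p_pr q_pr r_pr x_pr; rewrite !Euclid_dvdM // Euclid_dvdX // !dvdn_prime2 // !inE.
by case/orP=> [/orP[/andP[]|]|] ->; rewrite ?orbT.
Qed.

Section NonsolvableFour.

Variables (gT : finGroupType) (G : {group gT}).
Hypotheses (D4 : Dcount G = 4) (nsG : ~~ solvable G).

(** No nsn order is a proper multiple of q, so [Q] has prime index in its normalizer. That index is
    |N : C| |C : Q|, where |N : C| > 1 by transfer, so C = Q. *)
Lemma nonsol_prime_Sylow (p q r a : nat) (Q : {group gT}) :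
    [/\ prime p, prime q & prime r] -> [/\ q != p, q != r & r != p] ->
    #|G| = (p ^ a * q * r)%N ->
    (forall H : {group gT}, gval H \in nsn_subgroups G -> #|H| \in [:: p; p ^ 2; q; r]%N) ->
    Q \subset G -> #|Q| = q ->
  [/\ 'C_G(Q) = Q, #|'N_G(Q) : Q| \in [:: p; r] & #|'N_G(Q) : Q| %| q.-1].
Proof.
move=> [p_pr q_pr r_pr] [qp qr rp] oG nsn_in sQG oQ.
have qQ : q.-group Q by rewrite /pgroup oQ pnat_id.
have ntQ : Q :!=: 1 by rewrite -cardG_gt1 oQ prime_gt1.
have lognq : logn q #|G| = 1%N.
  rewrite oG !lognM ?muln_gt0 ?expn_gt0 ?prime_gt0 // lognX !logn_prime //.
  by rewrite (negPf qp) (negPf qr) eqxx muln0.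
have sylQ : q.-Sylow(G) Q by rewrite pHallE sQG oQ p_part lognq eqxx.
have cQQ : abelian Q by rewrite cyclic_abelian // prime_cyclic // oQ.
have nQ := nonsol_Sylow_nsn D4 nsG sylQ ntQ cQQ.
have sQN : Q \subset 'N_G(Q) by rewrite subsetI sQG normG.
have sCN : 'C_G(Q) \subset 'N_G(Q) by rewrite setIS ?cent_sub.
have sQC : Q \subset 'C_G(Q) by rewrite subsetI sQG.
have prN : prime #|'N_G(Q) : Q|.
  apply: prime_index_norm => //.
    apply: (@sol_index_norm _ _ _ (p ^ a * r)) => //.
    - by rewrite muln_gt0 expn_gt0 !prime_gt0.
    - by rewrite oQ oG mulnCA mulnA.
    apply: (@uniq_leq_size _ _ [:: p; r] (primes_uniq _)) => x.
    rewrite mem_primes => /and3P[x_pr _]; rewrite Euclid_dvdM // Euclid_dvdX //.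
    by rewrite !dvdn_prime2 // !inE => /orP[/andP[]|] ->; rewrite ?orbT.
  move=> H nH /cardSg; rewrite oQ; have := nsn_in H nH; rewrite !inE.
  case/or4P=> /eqP->; rewrite ?Euclid_dvdX ?dvdn_prime2 ?(negPf qp) ?(negPf qr) //.
have eqC : 'C_G(Q) = Q.
  have := Lagrange_index sCN sQC; move: prN => /[swap] <-.
  have [i1|i_neq1] := eqVneq #|'N_G(Q) : 'C_G(Q)| 1%N.
    case/negP: (nonsol_norm_cent_Sylow D4 nsG sylQ ntQ).
    by move/eqP: i1; rewrite indexg_eq1 subsetI => /andP[].
  have [i1|j_neq1] := eqVneq #|'C_G(Q) : Q| 1%N.
    by move=> _; apply/eqP; rewrite eqEsubset sQC andbT -indexg_eq1 i1.
  move=> prNC; have := dvdn_mulr #|'C_G(Q) : Q| (dvdnn #|'N_G(Q) : 'C_G(Q)|).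
  have /primeP[_ h] := prNC => /h; rewrite (negPf i_neq1) /= => /eqP eqi.
  move: j_neq1; rewrite -(eqn_pmul2l (indexg_gt0 'N_G(Q) 'C_G(Q))) muln1.
  by rewrite -eqi eqxx.
have dvN : #|'N_G(Q) : Q| %| q.-1.
  by have := index_norm_cent_prime G (_ : prime #|Q|); rewrite oQ eqC; apply.
split=> //.
have : #|'N_G(Q) : Q| %| p ^ a * q * r.
  by rewrite -oG; apply: dvdn_trans (dvdn_indexg _ _) _; rewrite cardSg ?subsetIl.
move/(dvd_ppow2 p_pr q_pr r_pr prN); rewrite !inE => /or3P[-> // | /eqP e | ->].
  have q1_gt0 : 0 < q.-1 by rewrite -subn1 subn_gt0 prime_gt1.
  by have := dvdn_leq q1_gt0 dvN; rewrite e leqNgt prednK ?leqnn // prime_gt0.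
by rewrite orbT.
Qed.

(** [x] centralizes its own power of order q, whose cyclic group is its own centralizer. *)
Lemma cent_prime_elt (q : nat) x :
    prime q -> (forall Q : {group gT}, Q \subset G -> #|Q| = q -> 'C_G(Q) = Q) ->
    x \in G -> q %| #[x] ->
  exists Q : {group gT}, [/\ Q \subset G, #|Q| = q & x \in Q].
Proof.
move=> q_pr cQ Gx dvx; pose y := x ^+ (#[x] %/ q).
have oy : #|<[y]>| = q.
  by rewrite -[#|_|]/#[y] orderXdiv ?dvdn_div // divnA // mulKn.
have sQG : <[y]> \subset G by rewrite cycle_subG groupX.
exists <[y]>%G; split=> //; rewrite -(cQ <[y]>%G) // inE Gx /=.
by rewrite cent_cycle; apply/cent1P; apply: commuteX.
Qed.

End NonsolvableFour.

(** * Counting elements when the order is p^a q r *)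

(** g is the group order, m and n the numbers of conjugates of subgroups of orders q and r, and s
    and t their indices in their normalizers. U and V are at most g/3 - 1 and A is at most g/4, so
    the total stays below g. *)
Lemma count_arith (g A U V q m s r n t : nat) :
    g = (q * s * m)%N -> g = (r * t * n)%N -> 0 < g -> 2 < s -> 2 < t ->
    U <= q.-1 * m -> V <= r.-1 * n -> 4 * A <= g -> g <= 1 + (A + U + V) ->
  False.
Proof.
move=> gq gr g_gt0 s_gt2 t_gt2 leU leV leA leg.
have hU : 3 * U + 3 <= g.
  have [q0 m0] : 0 < q /\ 0 < m by move: g_gt0; rewrite gq !muln_gt0 => /andP[/andP[-> _] ->].
  have : 3 * (q * m) <= g by rewrite gq; nia.
  have : (q.-1 * m + m = q * m)%N by case: (q) q0 => // k _; rewrite mulSn addnC.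
  by clear -leU m0; lia.
have hV : 3 * V + 3 <= g.
  have [r0 n0] : 0 < r /\ 0 < n by move: g_gt0; rewrite gr !muln_gt0 => /andP[/andP[-> _] ->].
  have : 3 * (r * n) <= g by rewrite gr; nia.
  have : (r.-1 * n + n = r * n)%N by case: (r) r0 => // k _; rewrite mulSn addnC.
  by clear -leV n0; lia.
by clear -hU hV leA leg; lia.
Qed.

Section NonsolvableStructure.

Variables (gT : finGroupType) (G : {group gT}) (p q r a : nat).
Hypotheses (D4 : Dcount G = 4) (nsG : ~~ solvable G).
Hypotheses (p_pr : prime p) (q_pr : prime q) (r_pr : prime r).
Hypotheses (lt_pq : p < q) (lt_pr : p < r) (neq_qr : q != r).
Hypothesis oG : #|G| = (p ^ a * q * r)%N.
Hypothesis nsn_in : forall H : {group gT},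
  gval H \in nsn_subgroups G -> #|H| \in [:: p; p ^ 2; q; r]%N.
Hypothesis nsn_conj : forall H K : {group gT},
  gval H \in nsn_subgroups G -> gval K \in nsn_subgroups G ->
  #|H| = #|K| -> exists2 x, x \in G & K :=: H :^ x.

Let neq_qp : q != p. Proof. by rewrite gtn_eqF. Qed.
Let neq_rp : r != p. Proof. by rewrite gtn_eqF. Qed.

Lemma nonsol_q (Q : {group gT}) : Q \subset G -> #|Q| = q ->
  [/\ 'C_G(Q) = Q, #|'N_G(Q) : Q| \in [:: p; r] & #|'N_G(Q) : Q| %| q.-1].
Proof. by apply: (nonsol_prime_Sylow D4 nsG _ _ oG). Qed.

Lemma nonsol_r (R : {group gT}) : R \subset G -> #|R| = r ->
  [/\ 'C_G(R) = R, #|'N_G(R) : R| \in [:: p; q] & #|'N_G(R) : R| %| r.-1].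
Proof.
apply: (@nonsol_prime_Sylow _ _ D4 nsG p r q a R) => //.
- by split; rewrite // eq_sym.
- by rewrite oG mulnAC.
move=> H /nsn_in; rewrite !inE => /or4P[] ->; rewrite ?orbT //.
Qed.

(** An element of order q or r centralizing [X] would have [X] in its centralizer, a group of order
    q or r. *)
Lemma nonsol_cent_pgroup (X : {group gT}) :
  p.-group X -> X :!=: 1 -> X \subset G -> p.-group 'C_G(X).
Proof.
move=> pX ntX sXG; apply/pgroupP=> u u_pr /(Cauchy u_pr)[y /setIP[Gy cXy] oy].
have sX : X \subset 'C_G(<[y]>) by rewrite subsetI sXG cent_cycle sub_cent1.
have uG : u \in [:: p; q; r].
  by apply: (dvd_ppow2 p_pr q_pr r_pr u_pr (a := a)); rewrite -oG -oy order_dvdG.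
have syG : <[y]> \subset G by rewrite cycle_subG.
have contra v : prime v -> v != p -> #|<[y]>| = v -> 'C_G(<[y]>) = <[y]> -> False.
  move=> v_pr neqv oyv cy; case/negP: ntX; rewrite -(setIidPl sX) cy.
  apply/eqP/coprime_TIg; rewrite oyv; apply: (pnat_coprime pX).
  by rewrite pnatE // !inE.
move: uG; rewrite !inE => /or3P[-> // | /eqP e | /eqP e]; rewrite e in oy.
  by have [cy _ _] := nonsol_q syG oy; case: (contra q).
by have [cy _ _] := nonsol_r syG oy; case: (contra r).
Qed.

(** By [cent_prime_elt], an element that is not a p-element lies in a conjugate of [Q] or [R]. As p
    > 2, the normalizer indices of [Q] and [R] are at least 3, as [count_arith] requires. *)
Lemma nonsol_count (A : {set gT}) :
    2 < p -> (forall x, x \in G -> x != 1 -> p.-elt x -> x \in class_support A G) ->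
  #|G| < 4 * (#|A| * #|G : 'N_G(A)|).
Proof.
move=> p_gt2 coverA; rewrite ltnNge; apply/negP=> leA.
have [Q sQG oQ] : exists2 Q : {group gT}, Q \subset G & #|Q| = (q ^ 1)%N.
  by apply: subgroup_of_order => //; rewrite oG expn1 mulnAC dvdn_mull.
have [R sRG oR] : exists2 R : {group gT}, R \subset G & #|R| = (r ^ 1)%N.
  by apply: subgroup_of_order => //; rewrite oG expn1 dvdn_mull.
rewrite expn1 in oQ; rewrite expn1 in oR.
have [_ iQ _] := nonsol_q sQG oQ; have [_ iR _] := nonsol_r sRG oR.
have conjQ (Q1 : {group gT}) : Q1 \subset G -> #|Q1| = q -> exists2 x, x \in G & Q1 :=: Q :^ x.
  have lognq : logn q #|G| = 1%N.
    rewrite oG !lognM ?muln_gt0 ?expn_gt0 ?prime_gt0 // lognX !logn_prime //.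
    by rewrite (negPf neq_qp) (negPf neq_qr) eqxx muln0.
  move=> sQ1G oQ1; apply: (Sylow_trans (p := q)).
    by rewrite pHallE sQG oQ p_part lognq eqxx.
  by rewrite pHallE sQ1G oQ1 p_part lognq eqxx.
have conjR (Q1 : {group gT}) : Q1 \subset G -> #|Q1| = r -> exists2 x, x \in G & Q1 :=: R :^ x.
  have lognr : logn r #|G| = 1%N.
    rewrite oG !lognM ?muln_gt0 ?expn_gt0 ?prime_gt0 // lognX !logn_prime //.
    by rewrite (negPf neq_rp) (eq_sym r) (negPf neq_qr) eqxx muln0.
  move=> sQ1G oQ1; apply: (Sylow_trans (p := r)).
    by rewrite pHallE sRG oR p_part lognr eqxx.
  by rewrite pHallE sQ1G oQ1 p_part lognr eqxx.
have cover : G^# \subset class_support A G :|: class_support Q^# G :|: class_support R^# G.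
  apply/subsetP=> x /setD1P[ntx Gx]; rewrite !inE.
  have [qx|nqx] := boolP (q %| #[x]).
    have [|Q1 [sQ1G oQ1 Q1x]] := cent_prime_elt q_pr _ Gx qx.
      by move=> Q1 sQ1 oQ1; have [] := nonsol_q sQ1 oQ1.
    have [y Gy defQ1] := conjQ Q1 sQ1G oQ1.
    apply/orP; left; apply/orP; right; rewrite class_supportEr.
    by apply/bigcupP; exists y => //; rewrite conjD1g !inE ntx -defQ1.
  have [rx|nrx] := boolP (r %| #[x]).
    have [|Q1 [sQ1G oQ1 Q1x]] := cent_prime_elt r_pr _ Gx rx.
      by move=> Q1 sQ1 oQ1; have [] := nonsol_r sQ1 oQ1.
    have [y Gy defQ1] := conjR Q1 sQ1G oQ1.
    apply/orP; right; rewrite class_supportEr.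
    by apply/bigcupP; exists y => //; rewrite conjD1g !inE ntx -defQ1.
  rewrite coverA //; apply/pgroupP=> u u_pr du.
  have := dvd_ppow2 p_pr q_pr r_pr u_pr (_ : u %| p ^ a * q * r).
  rewrite -oG (dvdn_trans du) ?order_dvdG // => /(_ isT); rewrite !inE.
  by case/or3P=> // /eqP eu; rewrite -eu du in nqx nrx.
have lQ := leq_card_class_support Q^# G; have lR := leq_card_class_support R^# G.
have lA := leq_card_class_support A G.
have cG : #|G| <= 1 + (#|class_support A G| + #|class_support Q^# G| + #|class_support R^# G|).
  rewrite (cardsD1 1 G) group1 leq_add2l (leq_trans (subset_leq_card cover)) //.
  by rewrite (leq_trans (leq_card_setU _ _)) ?leq_add2r ?leq_card_setU.
have cD1 (X : {group gT}) : #|X^#| = #|X|.-1 by rewrite (cardsD1 1 X) group1.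
rewrite normD1 cD1 oQ in lQ; rewrite normD1 cD1 oR in lR.
have idx (X : {group gT}) : X \subset G -> #|G| = (#|X| * #|'N_G(X) : X| * #|G : 'N_G(X)|)%N.
  by move=> sXG; rewrite Lagrange ?Lagrange ?subsetIl // subsetI sXG normG.
have gQ := idx Q sQG; have gR := idx R sRG; rewrite oQ in gQ; rewrite oR in gR.
apply: (count_arith gQ gR (cardG_gt0 G) _ _ lQ lR _ cG).
- move: iQ; rewrite !inE => /orP[] /eqP-> //; exact: ltn_trans lt_pr.
- move: iR; rewrite !inE => /orP[] /eqP-> //; exact: ltn_trans lt_pq.
by apply: leq_trans leA; rewrite leq_mul2l.
Qed.


Lemma nonsol_logp : logn p #|G| = a.
Proof.
rewrite oG !lognM ?muln_gt0 ?expn_gt0 ?prime_gt0 // lognX !logn_prime //.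
by rewrite eq_sym (negPf neq_qp) eq_sym (negPf neq_rp) eqxx !addn0 muln1.
Qed.

Lemma nonsol_psub_nsn (X : {group gT}) k :
  X \subset G -> #|X| = (p ^ k)%N -> 0 < k < a -> gval X \in nsn_subgroups G.
Proof.
move=> sXG oX /andP[k_gt0 lt_ka]; have [pX ntX] := ntriv_ppow p_pr k_gt0 oX.
apply: (nsn_not_Sylow pX) => //; rewrite pHallE sXG oX p_part nonsol_logp.
by rewrite eqn_exp2l ?prime_gt1 // ltn_eqF.
Qed.

Lemma nonsol_exponent3 : a != 3.
Proof.
apply/eqP=> a3; have [P sylP] := Sylow_exists p G.
have [sPG pP _] := and3P sylP.
have oP : #|P| = (p ^ 3)%N by rewrite (card_Hall sylP) p_part nonsol_logp a3.
have [_ ntP] := ntriv_ppow p_pr (isT : 0 < 3) oP.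
have nPP : 'N_G(P) = P.
  apply/eqP; apply: contraT => neqN.
  have /nsn_in : gval P \in nsn_subgroups G by rewrite nsnE sPG ntP.
  rewrite oP !inE -{2}(expn1 p) !eqn_exp2l ?prime_gt1 //=.
  by rewrite (negPf (expn_neq_prime _ q_pr _)) // (negPf (expn_neq_prime _ r_pr _)).
have ncP : ~~ abelian P.
  apply/negP=> cPP; have := nonsol_Sylow_nsn D4 nsG sylP ntP cPP.
  by rewrite nsnE nPP eqxx !andbF.
have ntZP : 'Z(P) != 1 by rewrite (center_nil_eq1 (pgroup_nil pP)).
have pZP : p.-group 'Z(P) := pgroupS (center_sub P) pP.
have [_ dvZ _] := pgroup_pdiv pZP ntZP.
have [z Zz oz] := Cauchy p_pr dvZ; pose Z := <[z]>%G.
have oZ : #|Z| = p by [].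
have sZZ : Z \subset 'Z(P) by rewrite cycle_subG.
have sZP : Z \subset P := subset_trans sZZ (center_sub P).
have sZG : Z \subset G := subset_trans sZP sPG.
have ntZ : Z :!=: 1 by rewrite -cardG_gt1 oZ prime_gt1.
have cZP : P \subset 'C(Z) by rewrite centsC (subset_trans sZZ) // subsetIr.
have cGZ : 'C_G(Z) = P.
  have pC := nonsol_cent_pgroup (pgroupS sZP pP) ntZ sZG.
  by apply: (sub_pHall sylP pC); rewrite ?subsetIl // subsetI sPG.
(* N_G(Z) normalizes C_G(Z), which is the self-normalizing [P]. *)
have nGZ : 'N_G(Z) = P.
  have nN : 'N_G(Z) \subset 'N('C_G(Z)).
    by rewrite normsI ?norms_cent ?subsetIr ?normsG ?subsetIl.
  rewrite cGZ in nN; apply/eqP; rewrite eqEsubset; apply/andP; split.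
    have : 'N_G(Z) \subset 'N_G(P) by rewrite subsetI subsetIl nN.
    by rewrite nPP.
  by rewrite subsetI sPG cents_norm.
have [Y sYP oY] : exists2 Y : {group gT}, Y \subset P & #|Y| = (p ^ 2)%N.
  by apply: subgroup_of_order; rewrite // oP dvdn_exp2l.
have nsn2 (X : {group gT}) : X \subset G -> #|X| = (p ^ 2)%N -> gval X \in nsn_subgroups G.
  by move=> sXG oX; apply: nonsol_psub_nsn oX _; rewrite // a3.
have cyc2 (X : {group gT}) : X \subset G -> #|X| = (p ^ 2)%N -> cyclic X = cyclic Y.
  move=> sXG oX; have nY := nsn2 Y (subset_trans sYP sPG) oY.
  have [x _ ->] := nsn_conj nY (nsn2 X sXG oX) (etrans oY (esym oX)).
  by rewrite cyclicJ.
have [cycY|ncycY] := boolP (cyclic Y).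
  (* A second subgroup of order p would span, with the central [Z], a noncyclic group of order
     p^2. *)
  have uniqZ (X : {group gT}) : X \subset P -> #|X| = p -> X :=: Z.
    move=> sXP oX; apply/eqP; apply: contraT => neqXZ.
    have tiXZ : X :&: Z = 1.
      apply: prime_TIg; rewrite ?oX //; apply: contra neqXZ => sXZ.
      by rewrite eqEcard sXZ oX oZ /=.
    have sXZ : X <*> Z \subset P by rewrite join_subG sXP.
    have oXZ : #|X <*> Z| = (p ^ 2)%N.
      rewrite cent_joinEl ?TI_cardMg ?oX ?oZ ?mulnn //; exact: subset_trans cZP.
    have cycXZ : cyclic (X <*> Z) by rewrite cyc2 // (subset_trans sXZ).
    case/negP: neqXZ; rewrite (eq_subG_cyclic cycXZ) ?joing_subl ?joing_subr //.
    by rewrite oX oZ.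
  (* If x and x^g are nontrivial in [P], corresponding powers of both generate the unique subgroup
     [Z] of order p, so g normalizes [Z] and lies in [P]. *)
  have tiP : normedTI P^# G P.
    apply/normedTI_memJ_P; split=> //; first by rewrite setD_eq0 subG1.
    move=> x g /setD1P[ntx Px] Gg; rewrite !inE conjg_eq1 ntx /=.
    apply/idP/idP=> [Pxg | Pg]; last by rewrite groupJ.
    have ntcx : <[x]> != 1 by rewrite cycle_eq1.
    have [_ dvx _] := pgroup_pdiv (mem_p_elt pP Px) ntcx.
    have [y cxy oy] := Cauchy p_pr dvx.
    have eqZ : <[y]> = Z.
      by apply: (uniqZ <[y]>%G) => //; rewrite cycle_subG (subsetP _ y cxy) ?cycle_subG.
    have eqZg : <[y ^ g]> = Z.
      apply: (uniqZ <[y ^ g]>%G); last by rewrite -[LHS]/#[_] orderJ.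
      rewrite cycle_subG; have : y ^ g \in <[x]> :^ g by rewrite memJ_conjg.
      by rewrite -cycleJ; apply/subsetP; rewrite cycle_subG.
    by rewrite -nGZ inE Gg; apply/normP; rewrite -{1}eqZ -cycleJ eqZg.
  have frobG : [Frobenius G with complement P].
    apply/andP; split=> //; apply: contraNneq nsG => eqPG.
    by rewrite -(group_inj eqPG); apply: pgroup_sol pP.
  (* The Frobenius kernel is a normal p-complement, hence would be all of [G]. *)
  have [K /andP[/eqP defG _]] := Frobenius_kernel_exists frobG.
  have [nsKG _ _ _ _] := sdprod_context defG.
  have hallK : p^'.-Hall(G) K.
    rewrite pHallE normal_sub // -(eqn_pmul2r (cardG_gt0 P)) (sdprod_card defG).
    by rewrite (card_Hall sylP) mulnC partnC ?cardG_gt0 //= eqxx.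
  have eqKG := nonsol_no_normal_complement D4 nsG nsKG hallK.
  have := sdprod_card defG; rewrite eqKG -[RHS]muln1 => /eqP.
  by rewrite eqn_pmul2l // -trivg_card1 (negPf ntP).
(* Order p^2 is impossible since such subgroups are noncyclic like [Y], and order p^3 since [P] is
   not abelian. *)
have expP x : x \in P -> x ^+ p = 1.
  move=> Px; have : #[x] %| p ^ 3 by rewrite -oP order_dvdG.
  case/dvdn_pfactor=> // k le_k3 ox; apply/eqP; rewrite -order_dvdn ox.
  case: k le_k3 ox => [|[|[|[|k]]]] // _ ox; rewrite ?expn1 //.
    by case/negP: ncycY; rewrite -(cyc2 <[x]>%G) ?cycle_cyclic // cycle_subG (subsetP sPG).
  case/negP: ncP; suff -> : P :=: <[x]> by apply: cycle_abelian.
  by apply/esym/eqP; rewrite eqEcard cycle_subG Px oP -ox leqnn.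
have p_neq2 : p != 2.
  apply: contra ncP => /eqP p2; apply: (@abelem_abelian _ 2).
  by apply/exponent2_abelem/exponentP=> x /expP; rewrite p2.
have p_gt2 : 2 < p by rewrite ltn_neqAle eq_sym p_neq2 prime_gt1.
have cD1 : p = (#|Z^#|).+1 by rewrite -oZ (cardsD1 1 Z) group1.
have nsn1 (X : {group gT}) : X \subset G -> #|X| = p -> gval X \in nsn_subgroups G.
  by move=> sXG oX; apply: (@nonsol_psub_nsn X 1); rewrite ?expn1 ?a3.
(* All subgroups of order p are conjugate to [Z], so [Z^#] covers the nontrivial p-elements up to
   conjugacy; the count yields p^3 < 4(p - 1), which is absurd. *)
have := @nonsol_count Z^# p_gt2; rewrite normD1 nGZ -(Lagrange sPG) oP => ltn.
have {}ltn : (p ^ 3 * #|G : P| < 4 * (#|Z^#| * #|G : P|))%N.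
  apply: ltn => x Gx ntx px; have sxG : <[x]> \subset G by rewrite cycle_subG.
  have [y Gy sxP] := Sylow_subJ sylP sxG px.
  have xp1 : x ^+ p = 1.
    have /expP : x ^ y^-1 \in P by rewrite -mem_conjg -cycle_subG.
    by rewrite -conjXg => /eqP; rewrite conjg_eq1 => /eqP.
  have ox := nt_prime_order p_pr xp1 ntx.
  have [w Gw defx] := nsn_conj (nsn1 Z sZG oZ) (nsn1 <[x]>%G sxG ox) (etrans oZ (esym ox)).
  rewrite class_supportEr; apply/bigcupP; exists w => //.
  by rewrite conjD1g !inE ntx -defx cycle_id.
have := indexg_gt0 G P; move: ltn cD1 p_gt2; clear => + + lt2p.
move: #|Z^#| #|G : P| => k n + eqp n_gt0; rewrite mulnA ltn_mul2r n_gt0 /= eqp; nia.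
Qed.

(** The index s = |N_G(P) : P| is q or r. If p > 2, then s > 3 and the conjugates of [P^#] are too
    few for [nonsol_count]. If p = 2, a subgroup of order s acts on [P] without nontrivial fixed
    points, so s divides 4 - 1. *)
Lemma nonsol_exponent2 (P : {group gT}) :
  a = 2 -> p.-Sylow(G) P -> [/\ p = 2, #|'N_G(P) : P| = 3 & (q == 3) || (r == 3)].
Proof.
move=> a2 sylP; have [sPG pP _] := and3P sylP.
have oP : #|P| = (p ^ 2)%N by rewrite (card_Hall sylP) p_part nonsol_logp a2.
have [_ ntP] := ntriv_ppow p_pr (isT : 0 < 2) oP.
have cPP : abelian P by apply: (p2group_abelian pP); rewrite oP pfactorK.
have nP := nonsol_Sylow_nsn D4 nsG sylP ntP cPP.
have sPN : P \subset 'N_G(P) by rewrite subsetI sPG normG.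
have prN : prime #|'N_G(P) : P|.
  apply: prime_index_norm => //.
    apply: (@sol_index_norm _ _ _ (q * r)) => //.
    - by rewrite muln_gt0 !prime_gt0.
    - by rewrite oP oG a2 mulnA.
    apply: (@uniq_leq_size _ _ [:: q; r] (primes_uniq _)) => x.
    rewrite mem_primes => /and3P[x_pr _]; rewrite Euclid_dvdM //.
    by rewrite !dvdn_prime2 // !inE.
  move=> H nH /cardSg; rewrite oP; have := nsn_in nH; rewrite !inE.
  have ndvd y : prime y -> p ^ 2 %| y -> False.
    by move=> y_pr; rewrite pfactor_dvdn ?prime_gt0 // logn_prime //; case: (p == y).
  by case/or4P=> /eqP-> // /ndvd; case.
have iqr : #|'N_G(P) : P| \in [:: q; r].
  have : #|'N_G(P) : P| %| q * r.
    rewrite -(@dvdn_pmul2l (p ^ 2)) ?expn_gt0 ?prime_gt0 // -{1}oP Lagrange //.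
    by rewrite mulnA -a2 -oG cardSg ?subsetIl.
  by rewrite Euclid_dvdM // !dvdn_prime2 // !inE.
have oN := Lagrange sPN; have oGN := Lagrange (subsetIl G 'N(P)).
have p2 : p = 2.
  apply/eqP; apply: contraT => p_neq2.
  have p_gt2 : 2 < p by rewrite ltn_neqAle eq_sym p_neq2 prime_gt1.
  have cov x : x \in G -> x != 1 -> p.-elt x -> x \in class_support P^# G.
    move=> Gx ntx px; have sxG : <[x]> \subset G by rewrite cycle_subG.
    have [y Gy sxP] := Sylow_subJ sylP sxG px.
    rewrite class_supportEr; apply/bigcupP; exists y => //.
    by rewrite conjD1g !inE ntx -cycle_subG.
  have := nonsol_count p_gt2 cov; rewrite normD1.
  have cD1 : #|P| = (#|P^#|).+1 by rewrite (cardsD1 1 P) group1.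
  have s_gt3 : 3 < #|'N_G(P) : P|.
    move: iqr; rewrite !inE => /orP[] /eqP->; [exact: leq_trans lt_pq | exact: leq_trans lt_pr].
  move: s_gt3 oN oGN; rewrite cD1; move: #|'N_G(P)| #|'N_G(P) : P| #|G : 'N_G(P)| #|P^#| #|G|.
  by clear => n s m k g s_gt3 <- <-; nia.
have [Y sYN oY] : exists2 Y : {group gT}, Y \subset 'N_G(P) & #|Y| = (#|'N_G(P) : P| ^ 1)%N.
  by apply: subgroup_of_order; rewrite // expn1 -oN dvdn_mull.
rewrite expn1 in oY; have sYG := subset_trans sYN (subsetIl _ _).
have cY : 'C_G(Y) = Y.
  move: iqr; rewrite !inE => /orP[] /eqP e; rewrite e in oY.
    by have [] := nonsol_q sYG oY.
  by have [] := nonsol_r sYG oY.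
have neqsp : #|'N_G(P) : P| != p.
  by move: iqr; rewrite !inE => /orP[] /eqP->.
have cPY : 'C_P(Y) = 1.
  apply/trivgP; rewrite -(_ : P :&: Y = 1); last first.
    apply: coprime_TIg; rewrite oY; apply: (pnat_coprime pP).
    by rewrite pnatE // !inE.
  by rewrite subsetI subsetIl -[X in _ \subset pred_of_set X]cY setSI.
have pY : (#|'N_G(P) : P|).-group Y by rewrite /pgroup oY pnat_id.
have := card_cent_mod pY (subset_trans sYN (subsetIr _ _)); rewrite cPY cards1 oP p2.
move/eqP; rewrite eqn_mod_dvd // dvdn_prime2 // => /eqP s3.
by split=> //; move: iqr; rewrite s3 !inE (eq_sym 3 q) (eq_sym 3 r).
Qed.

Lemma nonsol_order60 : a = 2 -> q = 3 ->
  [/\ #|G| = 60, exists2 H : {group gT}, H \subset G & #|G : H| = 5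
    & forall K : {group gT}, K <| G -> K :=: 1 \/ K :=: G].
Proof.
move=> a2 q3; have [P sylP] := Sylow_exists p G.
have [p2 s3 _] := nonsol_exponent2 a2 sylP.
have oG12 : #|G| = (12 * r)%N by rewrite oG a2 p2 q3.
have [R sRG oR] : exists2 R : {group gT}, R \subset G & #|R| = (r ^ 1)%N.
  by apply: subgroup_of_order => //; rewrite oG expn1 dvdn_mull.
rewrite expn1 in oR; have [cR iR _] := nonsol_r sRG oR.
have lognr : logn r #|G| = 1%N.
  rewrite oG !lognM ?muln_gt0 ?expn_gt0 ?prime_gt0 // lognX !logn_prime //.
  by rewrite (negPf neq_rp) (eq_sym r) (negPf neq_qr) eqxx muln0.
have sylR : r.-Sylow(G) R by rewrite pHallE sRG oR p_part lognr eqxx.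
have idx (X : {group gT}) : X \subset G -> #|G| = (#|X| * #|'N_G(X) : X| * #|G : 'N_G(X)|)%N.
  by move=> sXG; rewrite Lagrange ?Lagrange ?subsetIl // subsetI sXG normG.
(* The number of Sylow r-subgroups is 12 divided by 2 or 3. Being 1 modulo r, it is 6 with r = 5, as
   4 would give r = 3 = q. *)
have r5 : r = 5.
  have := card_Syl_mod G r_pr; rewrite (card_Syl sylR).
  have := idx R sRG; rewrite oG12 oR -mulnA mulnC => /eqP.
  rewrite eqn_pmul2l ?prime_gt0 //; move: iR; rewrite p2 q3 !inE.
  move: lt_pr neq_qr; rewrite p2 q3; move: #|G : _| #|_ : R| => n s; clear => lt2r neq3r.
  case/orP=> /eqP-> /eqP e.
    have -> : n = 6 by lia.
    move=> mod1; case: (ltnP r 7) => [|r_gt6]; last by rewrite modn_small in mod1.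
    by case: r lt2r neq3r mod1 => [|[|[|[|[|[|[|]]]]]]].
  have -> : n = 4 by lia.
  move=> mod1; case: (ltnP r 5) => [|r_gt6]; last by rewrite modn_small in mod1.
  by case: r lt2r neq3r mod1 => [|[|[|[|[|[|[|]]]]]]].
have oG60 : #|G| = 60 by rewrite oG12 r5.
have oP : #|P| = 4 by rewrite (card_Hall sylP) p_part nonsol_logp a2 p2.
split=> //.
  exists 'N_G(P)%G; first exact: subsetIl.
  have := idx P (pHall_sub sylP); rewrite oG60 oP s3 /= => /eqP.
  by rewrite -[60]/(4 * 3 * 5)%N eqn_pmul2l // => /eqP<-.
move=> K nsKG; have sKG := normal_sub nsKG.
have [->|ntK] := eqVneq (gval K) 1; first by left.
have [->|neqKG] := eqVneq (gval K) G; [by right | exfalso].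
have nK : 'N_G(K) = G by apply/setIidPl; apply: normal_norm.
(* [R], of order 5, would act on [K] without nontrivial fixed points, so 5 would divide 1 or 3. *)
have pK : #|K| = 2 \/ #|K| = 4 -> False.
  move=> oK; have rR : r.-group R by rewrite /pgroup oR pnat_id.
  have := card_cent_mod rR (subset_trans sRG (normal_norm nsKG)).
  suff -> : 'C_K(R) = 1 by rewrite cards1 r5; case: oK => ->.
  apply/trivgP; rewrite -(_ : K :&: R = 1); last first.
    by apply: coprime_TIg; rewrite oR r5; case: oK => ->.
  by rewrite subsetI subsetIl -[X in _ \subset pred_of_set X]cR setSI.
have := idx K sKG; rewrite nK indexgg muln1 oG60.
have : gval K \in nsn_subgroups G by apply: nsn_normal neqKG.
move/nsn_in; rewrite p2 !inE => /or4P[] /eqP oK.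
- by case: pK; left.
- by case: pK; right.
(* A normal [K] of order 3 or 5 would have prime index in its normalizer [G], against indices 20 and
   12. *)
- have [_ + _] := nonsol_q sKG oK; rewrite nK oK p2 q3 r5 !inE.
  by case/orP=> /eqP->.
have [_ + _] := nonsol_r sKG oK; rewrite nK oK p2 q3 r5 !inE.
by case/orP=> /eqP->.
Qed.

End NonsolvableStructure.

(** * Simple groups of order 60 *)

Section CosetAction.

Variables (gT : finGroupType) (G H : {group gT}) (n : nat).
Hypotheses (sHG : H \subset G) (iGH : #|G : H| = n.+1).

(** The cosets are numbered, with [rk] inverse to [e], so that for index 5 the action lands in the
    permutations of ['I_5], where [A5] lives. *)
Let e (i : 'I_n.+1) : {set gT} := nth set0 (enum (rcosets H G)) i.
Let rk (A : {set gT}) : 'I_n.+1 := inord (index A (enum (rcosets H G))).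

Let sz : size (enum (rcosets H G)) = n.+1.
Proof. by rewrite -cardE. Qed.

Let eT i : e i \in rcosets H G.
Proof. by rewrite -mem_enum mem_nth // sz. Qed.

Let rkK A : A \in rcosets H G -> e (rk A) = A.
Proof.
by rewrite -mem_enum => TA; rewrite /e inordK ?nth_index // -sz index_mem.
Qed.

Let eK i : rk (e i) = i.
Proof.
by apply: val_inj; rewrite /rk index_uniq ?enum_uniq ?sz // inord_val.
Qed.

(** Elements outside [G] act as the identity because an action must be injective for every group
    element, not only on its domain. *)
Definition coset_to (i : 'I_n.+1) (g : gT) : 'I_n.+1 :=
  if g \in G then rk (e i :* g) else i.

Let eTM i g : g \in G -> e i :* g \in rcosets H G.
Proof.
move=> Gg; have /rcosetsP[x Gx ->] := eT i.
by rewrite -rcosetM; apply/rcosetsP; exists (x * g); rewrite // groupM.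
Qed.

Fact coset_to_is_action : is_action G coset_to.
Proof.
split=> [g i j | i g h Gg Gh]; rewrite /coset_to.
  case: ifP => // Gg /(congr1 e); rewrite !rkK ?eTM // => /(congr1 (fun A => A :* g^-1)).
  by rewrite -!rcosetM mulgV !rcoset1 => eqe; rewrite -(eK i) eqe eK.
by rewrite Gg Gh groupM // rkK ?eTM // rcosetM.
Qed.

Canonical coset_to_action := Action coset_to_is_action.

Lemma coset_to_faithful : 1 < n.+1 ->
  (forall K : {group gT}, K <| G -> K :=: 1 \/ K :=: G) ->
  'injm (actperm coset_to_action).
Proof.
move=> n_gt0 simpG; case: (simpG _ (ker_normal (actperm_morphism coset_to_action))) => [-> //|kerG].
have : G \subset H.
  apply/subsetP=> g Gg; have : g \in 'ker (actperm coset_to_action) by rewrite kerG.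
  case/morphpreP=> _ /set1P/permP/(_ (rk H)); rewrite actpermE perm1 /=.
  have TH : (H : {set gT}) \in rcosets H G by apply/rcosetsP; exists 1; rewrite ?rcoset1.
  rewrite /coset_to Gg => /(congr1 e); rewrite rkK ?eTM // rkK // => eqH.
  by rewrite -eqH rcoset_refl.
by rewrite -indexg_eq1 iGH gtn_eqF.
Qed.

End CosetAction.

(** The elements acting evenly form a normal subgroup. Were it trivial, the image and the
    alternating group would have a product of 3600 elements inside a group of order 120. *)
Lemma simple60_isog_Alt (gT : finGroupType) (G H : {group gT}) :
    #|G| = 60 -> H \subset G -> #|G : H| = 5 ->
    (forall K : {group gT}, K <| G -> K :=: 1 \/ K :=: G) ->
  G \isog 'Alt_('I_5).
Proof.
move=> oG sHG iGH simpG.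
pose f := actperm_morphism (coset_to_action iGH).
have injf : 'injm f by apply: coset_to_faithful.
have oA : #|'Alt_('I_5)| = 60.
  have := @card_Alt 'I_5; rewrite card_ord => /(_ isT) /eqP.
  by rewrite -[5`!]/(2 * 60)%N eqn_pmul2l // => /eqP.
have ofG : #|f @* G| = 60 by rewrite card_injm.
suff sfA : f @* G \subset 'Alt_('I_5).
  have <- : f @* G = 'Alt_('I_5) by apply/eqP; rewrite eqEcard sfA oA ofG.
  exact: sub_isog.
have nsK : f @*^-1 'Alt_('I_5) <| G.
  rewrite /normal subsetIl; apply/subsetP=> x Gx; rewrite inE.
  apply/subsetP=> _ /imsetP[y /morphpreP[Gy Ay] ->].
  apply/morphpreP; split; first exact: groupJ.
  by rewrite morphJ // Alt_even odd_permJ -Alt_even.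
case: (simpG _ nsK) => [K1 | KG]; last first.
  by rewrite sub_morphim_pre // /= KG.
have ti : f @* G :&: 'Alt_('I_5) = 1.
  apply/trivgP; apply/subsetP=> _ /setIP[/morphimP[x Gx _ ->] Ax].
  have : x \in f @*^-1 'Alt_('I_5) by apply/morphpreP.
  by rewrite K1 => /set1P->; rewrite morph1 set11.
have := subset_leq_card (subsetT (f @* G * 'Alt_('I_5))).
by rewrite TI_cardMg // ofG oA cardsT card_Sn.
Qed.

Theorem nonsol_isog_A5 (gT : finGroupType) (G : {group gT}) :
  Dcount G = 4 -> ~~ solvable G -> G \isog A5.
Proof.
move=> D4 nsG; have [p [q [r [a []]]]] := nonsol_structure D4 nsG.
move=> [p_pr q_pr r_pr] [lt_pq lt_pr neq_qr] /andP[a_gt1 a_le3] oG [nsn_in nsn_conj].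
have a_neq3 : a != 3.
  exact: (nonsol_exponent3 D4 nsG p_pr q_pr r_pr lt_pq lt_pr neq_qr oG).
have a2 : a = 2 by move: a_gt1 a_le3 a_neq3; case: a {oG} => [|[|[|[|]]]].
have [P sylP] := Sylow_exists p G.
have [_ _ /orP[/eqP q3 | /eqP r3]] :=
  nonsol_exponent2 D4 nsG p_pr q_pr r_pr lt_pq lt_pr neq_qr oG nsn_in a2 sylP.
  have [oG60 [H sHG iGH] simpG] :=
    nonsol_order60 D4 nsG p_pr q_pr r_pr lt_pq lt_pr neq_qr oG nsn_in a2 q3.
  exact: simple60_isog_Alt iGH simpG.
(* Here r = 3, and the roles of q and r are exchanged. *)
have neq_rq : r != q by rewrite eq_sym.
have oG' : #|G| = (p ^ a * r * q)%N by rewrite oG mulnAC.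
have nsn_in' (H : {group gT}) : gval H \in nsn_subgroups G -> #|H| \in [:: p; p ^ 2; r; q]%N.
  by move/nsn_in; rewrite !inE => /or4P[] ->; rewrite ?orbT.
have [oG60 [H sHG iGH] simpG] :=
  nonsol_order60 D4 nsG p_pr r_pr q_pr lt_pr lt_pq neq_rq oG' nsn_in' a2 r3.
exact: simple60_isog_Alt iGH simpG.
Qed.

(** * Solvable groups *)

Lemma bigomegaX (p k : nat) : prime p -> bigomega (p ^ k) = k.
Proof.
move=> p_pr; elim: k => [|k IHk]; first exact: bigomega1.
by rewrite expnS bigomegaM ?expn_gt0 ?prime_gt0 // bigomega_prime // IHk.
Qed.

Lemma pgroup_max_cover (gT : finGroupType) (p : nat) (N : {group gT}) x :
    p.-group N -> ~~ cyclic N -> x \in N ->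
  exists M : {group gT}, [/\ M <| N, #|N : M| = p & x \in M].
Proof.
move=> pN ncN Nx; have sxN : <[x]> \subset N by rewrite cycle_subG.
have [eqxN|[M maxM sxM]] := maximal_exists sxN.
  by case/negP: ncN; rewrite -eqxN cycle_cyclic.
exists M; split; first exact: p_maximal_normal pN maxM.
  exact: p_maximal_index pN maxM.
by rewrite -cycle_subG.
Qed.

(** The maximal subgroups of a noncyclic [N] cover it, so a single one cannot suffice. *)
Lemma pgroup_unique_max_cyclic (gT : finGroupType) (p : nat) (N : {group gT}) :
    p.-group N ->
    (forall M1 M2 : {group gT}, M1 <| N -> M2 <| N -> #|N : M1| = p -> #|N : M2| = p ->
       M1 :=: M2) ->
  cyclic N.
Proof.
move=> pN uniqM; apply: contraT => ncN.
have [M [nsM iM _]] := pgroup_max_cover pN ncN (group1 N).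
have sNM : N \subset M.
  apply/subsetP=> x Nx; have [M1 [nsM1 iM1 M1x]] := pgroup_max_cover pN ncN Nx.
  by rewrite (uniqM M M1).
have ntN : N :!=: 1 by apply: contraNneq ncN => ->; rewrite cyclic1.
have [p_pr _ _] := pgroup_pdiv pN ntN.
by move: sNM; rewrite -indexg_eq1 iM; case: p p_pr {pN uniqM iM} => [|[]].
Qed.

Lemma der2_abelian_ext (gT : finGroupType) (G N : {group gT}) :
  N <| G -> abelian (G / N) -> abelian N -> G^`(2) = 1.
Proof.
move=> nsNG cGN cNN; have sG'N : G^`(1) \subset N by rewrite der1_min ?normal_norm.
apply/trivgP; apply: subset_trans (commgSS sG'N sG'N) _.
by rewrite -derg1 (derG1P cNN).
Qed.

(** * Solvable groups whose order has five prime factors *)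

Section SolvableFour.

Variables (gT : finGroupType) (G : {group gT}).
Hypotheses (D4 : Dcount G = 4) (solG : solvable G).

Lemma sol_bigomega_le5 : bigomega #|G| <= 5.
Proof.
rewrite leqNgt; apply/negP=> gt5;
have ex i : 0 < i < 6 -> exists2 n, nsn_order G n & bigomega n = i.
  by case/andP=> i_gt0 lti; apply: sol_nsn_bigomega; rewrite // i_gt0 (leq_trans lti).
have [n1 N1 o1] := ex 1%N isT; have [n2 N2 o2] := ex 2 isT; have [n3 N3 o3] := ex 3 isT.
have [n4 N4 o4] := ex 4 isT; have [n5 N5 o5] := ex 5 isT.
suff : 5 <= Dcount G by rewrite D4.
apply: (@size_leq_Dcount _ G [:: n1; n2; n3; n4; n5]); last by rewrite /= N1 N2 N3 N4 N5.
by apply: (@map_uniq _ _ bigomega); rewrite /= o1 o2 o3 o4 o5.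
Qed.

(** Nsn orders take the values 1, 2, 3, 4 of [bigomega], which already exhausts the four classes, so
    [bigomega] determines the class. *)
Lemma sol_bigomega5_conj : bigomega #|G| = 5 ->
  forall H K : {group gT}, gval H \in nsn_subgroups G -> gval K \in nsn_subgroups G ->
    bigomega #|H| = bigomega #|K| -> exists2 x, x \in G & K :=: H :^ x.
Proof.
move=> om5; have ex i : 0 < i < 5 -> exists2 n, nsn_order G n & bigomega n = i.
  by move=> lti; apply: sol_nsn_bigomega; rewrite // om5.
have [n1 N1 o1] := ex 1%N isT; have [n2 N2 o2] := ex 2 isT; have [n3 N3 o3] := ex 3 isT.
have [n4 N4 o4] := ex 4 isT; pose l := [:: n1; n2; n3; n4].
have uniq_om : uniq (map bigomega l) by rewrite /= o1 o2 o3 o4.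
have uniq_l : uniq l := map_uniq uniq_om.
have all_l : all (nsn_order G) l by rewrite /= N1 N2 N3 N4.
have [_ nsn_in nsn_conj] := nsn_order_exhaust uniq_l all_l (eq_leq D4).
move=> H K nH nK eq_om; apply: nsn_conj => //.
have := nsn_in H nH; have := nsn_in K nK; move: eq_om.
by rewrite !inE => /[swap] /or4P[] /eqP-> /[swap] /or4P[] /eqP->; rewrite // ?o1 ?o2 ?o3 ?o4.
Qed.

End SolvableFour.

Section SolvableFour.

Variables (gT : finGroupType) (G : {group gT}).
Hypotheses (D4 : Dcount G = 4) (solG : solvable G).

Lemma self_norm_prime_complement (q : nat) (Q : {group gT}) :
    Q \subset G -> #|Q| = q -> prime q -> 'N_G(Q) = Q ->
  q.-Sylow(G) Q /\ exists2 K : {group gT}, K <| G & q^'.-Hall(G) K.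
Proof.
move=> sQG oQ q_pr nQ.
have [qQ ntQ] : q.-group Q /\ Q :!=: 1.
  by apply: (ntriv_ppow (k := 1)); rewrite ?expn1.
have sylQ : q.-Sylow(G) Q.
  apply: contraT => nsylQ; have := nsn_not_Sylow qQ ntQ sQG nsylQ.
  by rewrite nsnE nQ eqxx !andbF.
split=> //; apply: (Burnside_normal_complement sylQ).
by rewrite nQ; apply: cyclic_abelian; apply: prime_cyclic; rewrite oQ.
Qed.

Lemma sol_bigomega5 : bigomega #|G| = 5 -> G^`(2) = 1.
Proof.
move=> om5; have nsn_conj := sol_bigomega5_conj D4 solG om5.
have G_gt1 : 1 < #|G|.
  by rewrite ltnNge; apply: contra_eqN om5; case: #|G| (cardG_gt0 G) => [|[]] //; rewrite bigomega1.
pose p0 := pdiv #|G|; have p0_pr : prime p0 := pdiv_prime G_gt1.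
have [p0G|np0G] := boolP (p0.-group G).
  have cycG : cyclic G.
    apply: (pgroup_unique_max_cyclic p0G) => M1 M2 nsM1 nsM2 i1 i2.
    have om (M : {group gT}) : M <| G -> #|G : M| = p0 ->
        gval M \in nsn_subgroups G /\ bigomega #|M| = 4.
      move=> nsM iM; have omM : bigomega #|M| = 4.
        have := om5; rewrite -(Lagrange (normal_sub nsM)) iM bigomegaM ?cardG_gt0 ?prime_gt0 //.
        by rewrite (bigomega_prime p0_pr) addn1 => -[].
      split=> //; apply: nsn_normal nsM _ _ _ => //.
        by apply: contra_eqN omM => /eqP->; rewrite cards1 bigomega1.
      by apply: contraTneq p0_pr => eqMG; rewrite -iM eqMG indexgg.
    have [n1 o1] := om M1 nsM1 i1; have [n2 o2] := om M2 nsM2 i2.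
    have [x Gx ->] := nsn_conj M1 M2 n1 n2 (etrans o1 (esym o2)).
    by apply/esym/normP; apply: (subsetP (normal_norm nsM1)).
  by apply: (der2_abelian_ext (normal_refl G)); rewrite ?cyclic_abelian // quotient_cyclic.
have nsn_prime_eq u v : prime u -> prime v -> nsn_order G u -> nsn_order G v -> u = v.
  move=> u_pr v_pr /nsn_orderP[U nU oU] /nsn_orderP[V nV oV].
  have [|x _ defV] := nsn_conj U V nU nV; first by rewrite oU oV !bigomega_prime.
  by rewrite -oU -oV defV cardJg.
(* Two distinct primes are not both nsn orders, so for one of two prime divisors a subgroup of that
   order is self-normalizing. *)
have [q [Q [q_pr sQG oQ nQ]]] : exists q (Q : {group gT}),
    [/\ prime q, Q \subset G, #|Q| = q & 'N_G(Q) = Q].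
  have [q1 q1_pr [dvq1 neq_q1]] : exists2 q, prime q & q %| #|G| /\ q != p0.
    have := np0G; rewrite /pgroup /pnat cardG_gt0 => /allPn[q].
    by rewrite mem_primes => /and3P[q_pr _ dvq] nq; exists q.
  have ex u : prime u -> u %| #|G| -> nsn_order G u \/ exists q (Q : {group gT}),
    [/\ prime q, Q \subset G, #|Q| = q & 'N_G(Q) = Q].
    move=> u_pr; rewrite -{1}(expn1 u) => /(subgroup_of_order u_pr)[U sUG].
    rewrite expn1 => oU; have [nU|nnU] := eqVneq 'N_G(U) U; first by right; exists u, U.
    left; apply/nsn_orderP; exists U => //; rewrite nsnE sUG nnU andbT /=.
    by rewrite -cardG_gt1 oU prime_gt1.
  have [n1|//] := ex q1 q1_pr dvq1; have [n2|//] := ex p0 p0_pr (pdiv_dvd _).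
  by case/eqP: neq_q1; apply: nsn_prime_eq.
have [sylQ [N nsNG hallN]] := self_norm_prime_complement sQG oQ q_pr nQ.
have oGN : (#|N| * q)%N = #|G|.
  by rewrite -oQ (card_Hall sylQ) (card_Hall hallN) mulnC partnC.
have iGN : #|G : N| = q.
  by apply/eqP; rewrite -(eqn_pmul2l (cardG_gt0 N)) Lagrange ?normal_sub // oGN.
have omN : bigomega #|N| = 4.
  by move: om5; rewrite -oGN bigomegaM ?cardG_gt0 ?prime_gt0 // (bigomega_prime q_pr) addn1 => -[].
have neqNG : N :!=: G.
  by apply: contraTneq q_pr => eqNG; rewrite -iGN eqNG indexgg.
have cGN : abelian (G / N).
  by apply: cyclic_abelian; apply: prime_cyclic; rewrite card_quotient ?iGN ?normal_norm.
have [cNN|ncN] := boolP (abelian N); first exact: der2_abelian_ext cNN.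
exfalso.
have ntN : N :!=: 1 by apply: contraNneq ncN => ->; apply: abelian1.
pose p := pdiv #|N|; have p_pr : prime p by rewrite pdiv_prime // cardG_gt1.
have neq_q u : prime u -> u %| #|N| -> u != q.
  move=> u_pr dvu; apply: contraTneq dvu => ->.
  by have /and3P[_ q'N _] := hallN; rewrite -p'natE.
have nsn_u u k : prime u -> u != q -> 0 < k -> u ^ k %| #|G| -> nsn_order G (u ^ k).
  move=> u_pr; exact: nsn_order_normal_complement hallN neqNG u_pr.
(* By Frattini, each prime divisor of [#|N|] is an nsn order, so there is only one. *)
have pN : p.-group N.
  apply/pgroupP=> u u_pr dvu; rewrite inE; apply/eqP.
  have nu v : prime v -> v %| #|N| -> nsn_order G v.
    move=> v_pr dvv; rewrite -(expn1 v); apply: nsn_u; rewrite ?neq_q // expn1.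
    by rewrite (dvdn_trans dvv) ?cardSg ?normal_sub.
  by apply: nsn_prime_eq; rewrite ?nu ?pdiv_dvd.
have oN : #|N| = (p ^ 4)%N.
  by rewrite (card_pgroup pN) in omN *; rewrite bigomegaX // in omN; rewrite omN.
have nsn_sub (X : {group gT}) k : X \subset N -> #|X| = (p ^ k)%N -> 0 < k ->
    gval X \in nsn_subgroups G.
  move=> sXN oX k_gt0; have [pX ntX] := ntriv_ppow p_pr k_gt0 oX.
  apply: (nsn_normal_complement nsNG hallN neqNG _ pX ntX).
    by apply: neq_q; rewrite ?pdiv_dvd.
  exact: subset_trans (normal_sub nsNG).
have conj_sub (X Y : {group gT}) k : X \subset N -> Y \subset N -> #|X| = (p ^ k)%N ->
    #|Y| = (p ^ k)%N -> 0 < k -> exists2 x, x \in G & Y :=: X :^ x.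
  by move=> sXN sYN oX oY k_gt0; apply: nsn_conj; rewrite ?(nsn_sub _ k) ?oX ?oY.
have ncycN : ~~ cyclic N by apply: contra ncN; apply: cyclic_abelian.
have ntZ : 'Z(N) != 1 by rewrite (center_nil_eq1 (pgroup_nil pN)).
have nsZG : 'Z(N) <| G := gFnormal_trans _ nsNG.
have sZN : 'Z(N) \subset N := center_sub N.
have [_ dvZ _] := pgroup_pdiv (pgroupS sZN pN) ntZ.
have [z Zz oz] := Cauchy p_pr dvZ; pose X0 := <[z]>%G.
have sX0 : X0 \subset 'Z(N) by rewrite cycle_subG.
have oX0 : #|X0| = (p ^ 1)%N by rewrite expn1.
(* The centre of [N] is normal in [G], so conjugates of its subgroups stay in it. *)
have sub_conj (A B : {group gT}) k : A \subset 'Z(N) -> B \subset N -> #|A| = (p ^ k)%N ->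
    #|B| = (p ^ k)%N -> 0 < k -> B \subset 'Z(N).
  move=> sA sB oA oB k_gt0; have [x Gx ->] := conj_sub A B k (subset_trans sA sZN) sB oA oB k_gt0.
  by rewrite -(normsP (normal_norm nsZG) x Gx) conjSg.
(* Two subgroups of order p would span a noncyclic central [E] of order p^2. Then no subgroup of
   that order is cyclic, so nontrivial elements of [N] have order p and are central, against
   [ncN]. *)
have uniqX (X : {group gT}) : X \subset N -> #|X| = p -> X :=: X0.
  move=> sXN oX; apply/eqP; apply: contraT => neqX.
  have sXZ : X \subset 'Z(N) by apply: sub_conj sX0 sXN oX0 _ _; rewrite ?expn1.
  have tiX : X :&: X0 = 1.
    apply: prime_TIg; rewrite ?oX //; apply: contra neqX => sXX.
    by rewrite eqEcard sXX oX oX0 expn1 leqnn.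
  have cX : X \subset 'C(X0).
    by rewrite (subset_trans sXZ) // (subset_trans (subsetIr _ _)) ?centS ?(subset_trans sX0).
  pose E := (X <*> X0)%G.
  have sEZ : E \subset 'Z(N) by rewrite join_subG sXZ.
  have oE : #|E| = (p ^ 2)%N by rewrite /= cent_joinEl ?TI_cardMg // oX oX0 expn1 mulnn.
  have ncycE : ~~ cyclic E.
    apply/negP=> cycE; case/negP: neqX.
    by rewrite (eq_subG_cyclic cycE) ?joing_subl ?joing_subr // oX oX0 expn1.
  case/negP: ncN; apply/centsP=> y Ny x Nx.
  suff /centerP[_ cy] : y \in 'Z(N) by apply: cy.
  have : #[y] %| p ^ 4 by rewrite -oN order_dvdG.
  case/dvdn_pfactor=> // k _ oy; have syN : <[y]> \subset N by rewrite cycle_subG.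
  case: k oy => [|[|k]] oy.
  - by have /eqP := oy; rewrite order_eq1 => /eqP->; apply: group1.
  - by rewrite -cycle_subG; apply: (sub_conj X0 <[y]>%G 1%N).
  have [Y sYy oY] : exists2 Y : {group gT}, Y \subset <[y]> & #|Y| = (p ^ 2)%N.
    by apply: subgroup_of_order; rewrite // -[#|_|]/#[y] oy dvdn_exp2l.
  have [g _ defY] := conj_sub E Y 2 (subset_trans sEZ sZN) (subset_trans sYy syN) oE oY isT.
  by case/negP: ncycE; rewrite -(cyclicJ _ g) -defY (cyclicS sYy) ?cycle_cyclic.
have nX0G : G \subset 'N(X0).
  apply/subsetP=> x Gx; apply/normP; apply: (uniqX (X0 :^ x)%G); last by rewrite /= cardJg oX0.
  rewrite -(normsP (normal_norm nsNG) x Gx) conjSg; exact: subset_trans sZN.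
(* [Q] acts on [X0] without nontrivial fixed points, so q divides p - 1. *)
have lt_qp : q < p.
  have qQ : q.-group Q by rewrite /pgroup oQ pnat_id.
  have := card_cent_mod qQ (subset_trans sQG nX0G).
  suff -> : 'C_X0(Q) = 1.
    rewrite cards1 oX0 expn1 => /eqP; rewrite eqn_mod_dvd ?prime_gt0 // => /dvdn_leq.
    rewrite subn_gt0 prime_gt1 // => /(_ isT) le_qp.
    by rewrite -(subnK (prime_gt0 p_pr)) addn1 ltnS.
  apply/trivgP; rewrite -(_ : X0 :&: Q = 1); last first.
    apply: coprime_TIg; rewrite oX0 expn1 oQ prime_coprime // dvdn_prime2 //.
    by apply: neq_q; rewrite ?pdiv_dvd.
  rewrite subsetI subsetIl /=; apply: subset_trans (_ : 'N_G(Q) \subset _); last by rewrite nQ.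
  rewrite setISS ?cent_sub //; exact: subset_trans (subset_trans sX0 sZN) (normal_sub nsNG).
have [M [nsMN iM _]] := pgroup_max_cover pN ncycN (group1 N).
have sMN := normal_sub nsMN.
have oMi (M1 : {group gT}) : M1 \subset N -> #|N : M1| = p -> #|M1| = (p ^ 3)%N.
  move=> sM1 iM1; apply/eqP; rewrite -(eqn_pmul2r (prime_gt0 p_pr)) -{1}iM1 Lagrange //.
  by rewrite oN -expnSr.
(* The maximal subgroups of [N] are conjugate, at most q < p in number, yet they cover [N], whose
   order is only p times theirs. *)
have cover : N \subset class_support M G.
  apply/subsetP=> x Nx; have [M1 [nsM1 iM1 M1x]] := pgroup_max_cover pN ncycN Nx.
  have [y Gy defM1] := conj_sub M M1 3 sMN (normal_sub nsM1) (oMi M sMN iM)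
    (oMi M1 (normal_sub nsM1) iM1) isT.
  by rewrite class_supportEr; apply/bigcupP; exists y => //; rewrite -defM1.
have le1 := leq_trans (subset_leq_card cover) (leq_card_class_support M G).
have le2 : #|G : 'N_G(M)| <= q.
  rewrite -iGN; apply: dvdn_leq; rewrite ?indexg_gt0 //; apply: indexgS.
  by rewrite subsetI (normal_sub nsNG) normal_norm.
have : #|N| <= #|M| * q by apply: leq_trans le1 _; rewrite leq_mul2l le2 orbT.
by rewrite -(Lagrange sMN) iM leq_mul2l leqNgt lt_qp orbF gtn_eqF ?cardG_gt0.
Qed.

End SolvableFour.

(** * Derived series when the order has at most four prime factors *)

(** [G] acts on [N] through the automorphism group of a cyclic group, which is abelian. *)
Lemma der1_cent_cyclic (gT : finGroupType) (G N : {group gT}) :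
  N <| G -> cyclic N -> G^`(1) \subset 'C(N).
Proof.
move=> nsNG cycN; have nNG := subsetP (normal_norm nsNG).
rewrite gen_subG; apply/subsetP=> _ /imset2P[x y Gx Gy ->].
suff : [~ x, y] \in 'ker (conj_aut N) by rewrite ker_conj_aut.
apply/kerP; rewrite ?groupR ?nNG //.
rewrite morphR ?nNG //; apply/eqP/commgP.
have cA := Aut_cyclic_abelian cycN.
by apply: (centsP cA); apply: Aut_aut.
Qed.

(** G' centralizes the cyclic G'', so G' is cyclic modulo a central subgroup and therefore
    abelian. *)
Lemma der2_cyclic (gT : finGroupType) (G : {group gT}) :
  cyclic G^`(2) -> cyclic (G^`(1) / G^`(2)) -> G^`(2) = 1.
Proof.
move=> cyc2 cyc1; have ns2 : G^`(2) <| G := der_normal 2 G.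
have cG' := der1_cent_cyclic ns2 cyc2.
have s21 : G^`(2) \subset G^`(1) := der_sub 1 _.
have sZ : G^`(2) \subset 'Z(G^`(1)) by rewrite subsetI s21 centsC.
exact/derG1P/(cyclic_factor_abelian sZ).
Qed.

(** [der2_cyclic] in the quotient by G''' gives G'' = G''', which solvability allows only when G'' =
    1. *)
Lemma sol_der2_cyclic (gT : finGroupType) (G : {group gT}) :
    solvable G -> cyclic (G^`(1) / G^`(2)) -> cyclic (G^`(2) / G^`(3)) ->
  G^`(2) = 1.
Proof.
move=> solG cyc1 cyc2; apply/eqP; apply: contraT => nt2.
have ns3 : G^`(3) <| G := der_normal 3 G.
have : (G / G^`(3))^`(2) = 1.
  apply: der2_cyclic; rewrite -!quotient_der ?normal_norm //.
  have s32 : G^`(3) \subset G^`(2) := der_sub 1 _.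
  have ns31 : G^`(3) <| G^`(1).
    have s21 : G^`(2) \subset G^`(1) := der_sub 1 _.
    exact: normalS (subset_trans s32 s21) (der_sub 1 G) ns3.
  have ns21 : G^`(2) <| G^`(1) := der_normal 1 _.
  by rewrite (isog_cyclic (third_isog s32 ns31 ns21)).
rewrite -quotient_der ?normal_norm // => /trivgP.
rewrite quotient_sub1; last by rewrite (subset_trans (der_sub 2 G)) ?normal_norm.
move=> s23; have := sol_der1_proper solG (der_sub 2 G) nt2.
by rewrite properE s23 andbF.
Qed.

Lemma abelian_pq_cyclic (gT : finGroupType) (A : {group gT}) (u v : nat) :
  abelian A -> prime u -> prime v -> u != v -> #|A| = (u * v)%N -> cyclic A.
Proof.
move=> cAA u_pr v_pr neq_uv oA.
have [x Ax ox] : {x | x \in A & #[x] = u} by apply: Cauchy; rewrite // oA dvdn_mulr.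
have [y Ay oy] : {y | y \in A & #[y] = v} by apply: Cauchy; rewrite // oA dvdn_mull.
apply/cyclicP; exists (x * y); apply/esym/eqP.
rewrite eqEcard cycle_subG groupM //= -[X in _ <= X]/#[x * y] orderM ?ox ?oy ?oA //.
  exact: (centsP cAA).
by rewrite prime_coprime // dvdn_prime2.
Qed.

(** G/G', G'/G'' and G'' are nontrivial and share at most four primes, so at most one of them has
    two. As G'/G'' and G''/G''' are not both cyclic, the extra prime sits in G'' or in G'/G''. *)
Lemma sol_der2_structure (gT : finGroupType) (G : {group gT}) :
    solvable G -> bigomega #|G| <= 4 -> G^`(2) != 1 ->
    (exists s p, [/\ prime s, prime p, #|G^`(2)| = s, #|G^`(1)| = (s ^ 3)%N & #|G : G^`(1)| = p])
  \/ (exists s r p, [/\ [/\ prime s, prime r & prime p], #|G^`(2)| = (s ^ 2)%N,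
        #|G^`(1) : G^`(2)| = r, #|G : G^`(1)| = p & abelian G^`(2) /\ ~~ cyclic G^`(2)]).
Proof.
move=> solG om4 nt2; have s10 : G^`(1) \subset G := der_sub 1 G.
have s21 : G^`(2) \subset G^`(1) := der_sub 1 _.
have s20 := subset_trans s21 s10.
have nt1 : G^`(1) != 1 by apply: contraNneq nt2 => e; rewrite -subG1 -e.
have nt0 : G :!=: 1 by apply: contraNneq nt1 => e; rewrite -subG1 -e.
have i_gt1 (A B : {group gT}) : A \proper B -> 1 < #|B : A| by rewrite indexg_gt1 => /andP[].
have i1 : 1 < #|G : G^`(1)| := i_gt1 _ _ (sol_der1_proper solG (subxx G) nt0).
have i2 : 1 < #|G^`(1) : G^`(2)| := i_gt1 _ _ (sol_der1_proper solG s10 nt1).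
have i3 : 1 < #|G^`(2)| by rewrite cardG_gt1.
have omG : bigomega #|G| = (bigomega #|G^`(2)| + bigomega #|G^`(1) : G^`(2)| + bigomega #|G : G^`(1)|)%N.
  rewrite -(Lagrange s10) -(Lagrange s21) !bigomegaM ?muln_gt0 ?indexg_gt0 ?cardG_gt0 //.
have b1 := bigomega_gt0 i1; have b2 := bigomega_gt0 i2; have b3 := bigomega_gt0 i3.
have n21 : G^`(1) \subset 'N(G^`(2)) := der_norm 1 _.
have cyc_or : cyclic (G^`(1) / G^`(2)) -> cyclic (G^`(2) / G^`(3)) -> False.
  by move=> c1 c2; case/eqP: nt2; apply: sol_der2_cyclic.
have pr_cyc1 : bigomega #|G^`(1) : G^`(2)| = 1%N -> cyclic (G^`(1) / G^`(2)).
  move=> e; apply: prime_cyclic; rewrite card_quotient //.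
  exact: bigomega_eq1 (indexg_gt0 _ _) e.
rewrite omG in om4.
case e3: (bigomega #|G^`(2)|) b3 om4 => [|[|[|n]]] // _ om4; last first.
- exfalso; clear -om4 b1 b2; lia.
- right; have [e2 e1] : bigomega #|G^`(1) : G^`(2)| = 1%N /\ bigomega #|G : G^`(1)| = 1%N.
    by clear -om4 b1 b2; split; lia.
  have nc2 : ~~ cyclic (G^`(2) / G^`(3)) by apply/negP; apply: cyc_or; apply: pr_cyc1.
  have G3 : G^`(3) = 1.
    apply/eqP; apply: contraT => nt3; case/negP: nc2.
    have s32 : G^`(3) \subset G^`(2) := der_sub 1 _.
    apply: prime_cyclic; rewrite card_quotient; last exact: (der_norm 1 _).
    apply: bigomega_eq1 (indexg_gt0 _ _) _.
    have := e3; rewrite -(Lagrange s32) bigomegaM ?indexg_gt0 ?cardG_gt0 //.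
    have i32 : 1 < #|G^`(2) : G^`(3)| := i_gt1 _ _ (sol_der1_proper solG s20 nt2).
    have := bigomega_gt0 i32.
    have : 0 < bigomega #|G^`(3)| by apply: bigomega_gt0; rewrite cardG_gt1.
    have arith (x y : nat) : 0 < x -> 0 < y -> (x + y)%N = 2 -> y = 1%N by clear; lia.
    exact: arith.
  have cV : abelian G^`(2) by apply/derG1P.
  have ncV : ~~ cyclic G^`(2).
    by apply: contra nc2; apply: quotient_cyclic.
  have [u [v [u_pr v_pr oV]]] := bigomega_eq2 (cardG_gt0 _) e3.
  have euv : u = v.
    by apply/eqP; apply: contraT => neq; case/negP: ncV; apply: abelian_pq_cyclic neq oV.
  exists u, #|G^`(1) : G^`(2)|, #|G : G^`(1)|; split=> //.
    by split=> //; apply: bigomega_eq1 (indexg_gt0 _ _) _.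
  by rewrite oV -euv mulnn.
left; have pr_V := bigomega_eq1 (cardG_gt0 _) e3.
have cycV : cyclic G^`(2) by apply: prime_cyclic.
have nc1 : ~~ cyclic (G^`(1) / G^`(2)).
  by apply/negP=> c1; apply: cyc_or c1 _; apply: quotient_cyclic.
have [e2 e1] : bigomega #|G^`(1) : G^`(2)| = 2 /\ bigomega #|G : G^`(1)| = 1%N.
  have : bigomega #|G^`(1) : G^`(2)| <> 1%N by move=> e; case/negP: nc1; apply: pr_cyc1.
  by clear -om4 b1 b2; split; lia.
have [u [v [u_pr v_pr oI]]] := bigomega_eq2 (indexg_gt0 _ _) e2.
have cGV : abelian (G^`(1) / G^`(2)) := der_abelian 1 G.
have euv : u = v.
  apply/eqP; apply: contraT => neq; case/negP: nc1.
  by apply: abelian_pq_cyclic neq _; rewrite ?card_quotient.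
exists #|G^`(2)|, #|G : G^`(1)|; split=> //; last 2 first.
- exact: bigomega_eq1 (indexg_gt0 _ _) _.
- rewrite -(Lagrange s21) oI -euv mulnn.
  suff -> : u = #|G^`(2)| by rewrite -expnS.
  (* For u different from [#|G''|], G' would be the product of an abelian Sylow u-subgroup and the
     central G'', hence abelian. *)
  apply/eqP; apply: contraT => neq_us; case/eqP: nt2.
  have cV : G^`(1) \subset 'C(G^`(2)) := der1_cent_cyclic (der_normal 2 G) cycV.
  have [U sylU] := Sylow_exists u G^`(1).
  have oU : #|U| = (u ^ 2)%N.
    rewrite (card_Hall sylU) -(Lagrange s21) oI -euv mulnn p_part.
    by rewrite lognM ?expn_gt0 ?prime_gt0 // logn_prime // (negPf neq_us) lognX logn_prime // eqxx.
  have cUU : abelian U.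
    by apply: (p2group_abelian (pHall_pgroup sylU)); rewrite oU pfactorK.
  have cUV : U \subset 'C(G^`(2)) := subset_trans (pHall_sub sylU) cV.
  have defG' : U * G^`(2) = G^`(1).
    apply/eqP; rewrite eqEcard mul_subG ?(pHall_sub sylU) //= coprime_cardMg.
      by rewrite oU -(Lagrange s21) oI -euv mulnn mulnC.
    by rewrite oU coprime_pexpl // prime_coprime // dvdn_prime2.
  have : abelian (U * G^`(2)) by rewrite abelianM cUU (cyclic_abelian cycV) centsC.
  by rewrite defG' => cG'; apply/derG1P.
Qed.

(** [v * v ^ t] is fixed by [t], hence trivial. *)
Lemma invol_inverts_abelian (gT : finGroupType) (V : {group gT}) t v :
    t ^+ 2 = 1 -> t \in 'N(V) -> abelian V -> 'C_V[t] = 1 -> v \in V -> v ^ t = v^-1.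
Proof.
move=> t2 nVt cVV cVt Vv; have Vvt : v ^ t \in V by rewrite memJ_norm.
apply/esym/eqP; rewrite eq_invg_mul.
suff : v * v ^ t \in 'C_V[t] by rewrite cVt => /set1P->.
rewrite inE groupM //=; apply/cent1P/commgP/conjg_fixP.
by rewrite conjMg -conjgM -[t * t]/(t ^+ 2) t2 conjg1 (centsP cVV).
Qed.

Lemma prime_generator (gT : finGroupType) (R : {group gT}) y :
  prime #|R| -> y \in R -> y != 1 -> <[y]> = R.
Proof.
move=> prR Ry nty; apply/eqP; rewrite eqEsubset cycle_subG Ry /=.
apply: prime_meetG prR _; rewrite (setIidPr _) ?cycle_subG //.
by rewrite cycle_eq1.
Qed.

Lemma self_norm_cent_trivial (gT : finGroupType) (G P A : {group gT}) :
  'N_G(P) = P -> A \subset G -> coprime #|A| #|P| -> 'C_A(P) = 1.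
Proof.
move=> nP sAG co; apply/trivgP; rewrite -(coprime_TIg co) subsetI subsetIl /=.
apply: subset_trans (_ : 'N_G(P) \subset _); last by rewrite nP.
by rewrite setISS ?cent_sub.
Qed.

Lemma four_no_rank2_der2 (gT : finGroupType) (G : {group gT}) (s r p : nat) :
    Dcount G = 4 -> prime s -> prime r -> prime p ->
    #|G^`(2)| = (s ^ 2)%N -> #|G^`(1) : G^`(2)| = r -> #|G : G^`(1)| = p ->
    abelian G^`(2) -> ~~ cyclic G^`(2) ->
  False.
Proof.
move=> D4 s_pr r_pr p_pr oV ir ip cVV ncV.
pose G1 := G^`(1)%G; pose V := G^`(2)%G.
have sG1G : G1 \subset G := der_sub 1 G.
have sVG1 : V \subset G1 := der_sub 1 _.
have nsG1G : G1 <| G := der_normal 1 G.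
have nsVG : V <| G := der_normal 2 G.
have nsVG1 : V <| G1 := der_normal 1 _.
have sVG := normal_sub nsVG.
have ntV : V :!=: 1 by rewrite -cardG_gt1 oV (ltn_exp2l 0) ?prime_gt1.
have oG1 : #|G1| = (s ^ 2 * r)%N by rewrite -(Lagrange sVG1) oV ir.
have oG : #|G| = (s ^ 2 * r * p)%N by rewrite -(Lagrange sG1G) oG1 ip.
have ncG1 : ~~ abelian G1.
  by apply: contra ntV => /derG1P e; apply/eqP.
have sV : s.-group V by rewrite /pgroup oV pnatX pnat_id.
(* With r = s, G' would be a nilpotent group with cyclic abelianization, hence cyclic. *)
have neq_rs : r != s.
  apply: contra ncG1 => /eqP ers; apply: cyclic_abelian.
  apply: cyclic_nilpotent_quo_der1_cyclic.
    by apply: (@pgroup_nil _ s); rewrite /pgroup oG1 ers -expnSr pnatX pnat_id.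
  by apply: prime_cyclic; rewrite card_quotient ?der_norm // [#|_ : _|]ir.
have neq_rp : r != p.
  apply/negP=> /eqP erp.
  have iGV : #|G / V| = (r ^ 2)%N.
    by rewrite card_quotient ?normal_norm // -(Lagrange_index sG1G sVG1) ip ir -erp mulnn.
  have rGV : r.-group (G / V) by rewrite /pgroup iGV pnatX pnat_id.
  have cGV : abelian (G / V) by apply: (p2group_abelian rGV); rewrite iGV pfactorK.
  have sG1V : G1 \subset V by rewrite der1_min ?normal_norm.
  by move: r_pr; rewrite -ir (_ : #|_ : _| = 1%N) //; apply/eqP; rewrite indexg_eq1.
have neqG1 : G1 :!=: G.
  by apply: contraTneq p_pr => e; rewrite -ip -[G^`(1)]/(gval G1) e indexgg.
have neqV1 : V :!=: G1.
  by apply: contraTneq r_pr => e; rewrite -ir -[G^`(2)]/(gval V) e indexgg.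
have [x R1x ox] : {x | x \in G1 & #[x] = r} by apply: Cauchy; rewrite // oG1 dvdn_mull.
pose R := <[x]>%G; have oR : #|R| = r by [].
have sRG1 : R \subset G1 by rewrite cycle_subG.
have sRG := subset_trans sRG1 sG1G.
have rR : r.-group R by rewrite /pgroup oR pnat_id.
have ntR : R :!=: 1 by rewrite -cardG_gt1 oR prime_gt1.
have sylR : r.-Sylow(G1) R.
  rewrite pHallE sRG1 oR p_part oG1 lognM ?expn_gt0 ?prime_gt0 // lognX !logn_prime //.
  by rewrite (negPf neq_rs) eqxx muln0 add0n expn1 eqxx.
have defG := Frattini_arg nsG1G sylR.
have nR : gval R \in nsn_subgroups G.
  rewrite nsnE sRG ntR /=; apply: contra neqG1 => /eqP nRR.
  by rewrite -defG nRR mulGSid.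
have nV : gval V \in nsn_subgroups G by apply: nsn_normal nsVG1 sG1G ntV neqV1.
have nG1 : gval G1 \in nsn_subgroups G.
  by apply: nsn_normal nsG1G _ _ neqG1; rewrite // -cardG_gt1 (leq_trans _ (subset_leq_card sVG1)) ?cardG_gt1.
pose l := [:: s; r; s ^ 2; s ^ 2 * r]%N.
have om_l : uniq l.
  have cmp : (s ^ 2 * r)%N \notin [:: s; r; s ^ 2]%N.
    have [s_gt1 r_gt1] := (prime_gt1 s_pr, prime_gt1 r_pr).
    by rewrite !inE !negb_or; clear -s_gt1 r_gt1; apply/and3P; split; apply/eqP; nia.
  rewrite /l -[uniq _]/(uniq (rcons [:: s; r; s ^ 2]%N (s ^ 2 * r)%N)) rcons_uniq cmp /=.
  rewrite !inE !negb_or (eq_sym s r) neq_rs (eq_sym s) (eq_sym r).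
  by rewrite !expn_neq_prime.
have all_l : all (nsn_order G) l.
  rewrite /= andbT; apply/and4P; split.
  - by rewrite -(expn1 s); apply: nsn_order_not_Sylow; rewrite // oG -mulnA dvdn_mulr.
  - by apply/nsn_orderP; exists R.
  - by apply/nsn_orderP; exists V.
  by apply/nsn_orderP; exists G1.
have [_ nsn_in nsn_conj] := nsn_order_exhaust om_l all_l (eq_leq D4).
have eqV (M : {group gT}) : gval M \in nsn_subgroups G -> #|M| = (s ^ 2)%N -> M :=: V.
  move=> nM oM; have [y Gy ->] := nsn_conj V M nV nM (etrans oV (esym oM)).
  by apply/normP; apply: (subsetP (normal_norm nsVG)).
(* If p = s, every maximal subgroup of a Sylow s-subgroup [T] is [V], so [T] is cyclic, and [V] with
   it. *)
have [eps|neq_ps] := eqVneq p s.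
  have [T sylT] := Sylow_exists s G; have sT := pHall_pgroup sylT.
  have oT : #|T| = (s ^ 3)%N.
    rewrite (card_Hall sylT) p_part oG eps !lognM ?muln_gt0 ?expn_gt0 ?prime_gt0 //.
    by rewrite !logn_prime // eqxx (eq_sym s) (negPf neq_rs).
  have cycT : cyclic T.
    apply: (pgroup_unique_max_cyclic sT) => M1 M2 ns1 ns2 i1 i2.
    have eqM (M : {group gT}) : M <| T -> #|T : M| = s -> M :=: V.
      move=> nsM iM; have sMT := normal_sub nsM.
      have oM : #|M| = (s ^ 2)%N.
        apply/eqP; rewrite -(eqn_pmul2r (prime_gt0 s_pr)) -{1}iM Lagrange // oT.
        by rewrite -expnSr.
      apply: (eqV _ _ oM); have [pM ntM] := ntriv_ppow s_pr (isT : 0 < 2) oM.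
      apply: nsn_not_Sylow pM ntM (subset_trans sMT (pHall_sub sylT)) _.
      rewrite pHallE oM -(card_Hall sylT) oT eqn_exp2l ?prime_gt1 //.
      by rewrite andbF.
    exact: etrans (eqM M1 ns1 i1) (esym (eqM M2 ns2 i2)).
  have [y Gy sVT] := Sylow_subJ sylT sVG sV.
  by case/negP: ncV; apply: (cyclicS sVT); rewrite cyclicJ.
have defG1 : V * R = G1.
  apply/eqP; rewrite eqEcard mul_subG //= coprime_cardMg ?oV ?oR ?oG1 //.
  by rewrite coprime_pexpl // prime_coprime // dvdn_prime2 // eq_sym.
have ncVR : ~~ (R \subset 'C(V)).
  apply: contra ncG1 => cRV; rewrite -defG1 abelianM cVV cRV andbT /=.
  by apply: cycle_abelian.
have [t Nt ot] : {t | t \in 'N_G(R) & #[t] = p}.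
  apply: Cauchy => //; rewrite -ip -card_quotient ?normal_norm // -{1}defG quotientMidl.
  exact: dvdn_quotient.
have [Gt nRt] := setIP Nt; pose P := <[t]>%G; have oP : #|P| = p by [].
have sPG : P \subset G by rewrite cycle_subG.
have ntP : P :!=: 1 by rewrite -cardG_gt1 oP prime_gt1.
have pP : p.-group P by rewrite /pgroup oP pnat_id.
(* p is none of the four nsn orders; this makes [P] act on [R] and on [V] without nontrivial fixed
   points. *)
have nP : 'N_G(P) = P.
  apply/eqP; apply: contraT => nnP.
  have /nsn_in : gval P \in nsn_subgroups G by rewrite nsnE sPG ntP.
  rewrite oP !inE (negPf neq_ps) (eq_sym p r) (negPf neq_rp) eq_sym.
  rewrite (negPf (expn_neq_prime _ _ _)) //= => /eqP ep.
  have := p_pr; rewrite ep => /primeP[_ /(_ r (dvdn_mull _ (dvdnn r)))].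
  have [s_gt1 r_gt1] := (prime_gt1 s_pr, prime_gt1 r_pr).
  by clear -s_gt1 r_gt1 => /orP[] /eqP; nia.
have cRP : 'C_R(P) = 1.
  by apply: (self_norm_cent_trivial nP); rewrite ?oP ?oR // prime_coprime ?dvdn_prime2.
have cVP : 'C_V(P) = 1.
  apply: (self_norm_cent_trivial nP); rewrite ?oP ?oV // coprime_pexpl //.
  by rewrite prime_coprime ?dvdn_prime2 // eq_sym.
have lt_pr : p < r.
  have nRP : P \subset 'N(R) by rewrite cycle_subG.
  have := card_cent_mod pP nRP; rewrite cRP cards1 oR => /eqP.
  rewrite eqn_mod_dvd ?prime_gt0 // => /dvdn_leq; rewrite subn_gt0 prime_gt1 //.
  by move/(_ isT); rewrite -{2}(subnK (prime_gt0 r_pr)) addn1 ltnS.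
have r_gt2 : 2 < r by apply: leq_trans lt_pr; rewrite ltnS prime_gt1.
(* The s + 1 subgroups of order s in [V] form one class, and [V] normalizes each of them, so their
   number divides |G : V| = r p. *)
have dv_s1 : s.+1 %| r * p.
  have abV : s.-abelem V.
    apply/abelemP=> //; split=> // v Vv; apply/eqP; rewrite -order_dvdn.
    have : #[v] %| s ^ 2 by rewrite -oV order_dvdG.
    case/dvdn_pfactor=> // -[|[|[|k]]] // _ ov; rewrite ov ?expn1 //.
    case/negP: ncV; suff <- : <[v]> = V by apply: cycle_cyclic.
    by apply/eqP; rewrite eqEcard cycle_subG Vv -[#|<[v]>|]/#[v] ov oV leqnn.
  have E2V : V \in 'E_s^2(V) by apply/pnElemP; split=> //; rewrite oV pfactorK.
  have cardE := card_p1Elem_p2Elem E2V.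
  have nX (X : {group gT}) : X \in 'E_s^1(V) -> gval X \in nsn_subgroups G.
    move=> EX; have oX := card_p1Elem EX; have [sXV _ _] := pnElemP EX.
    apply: (nsn_normal (K := V)) => //.
    - by rewrite /normal sXV cents_norm // centsC (subset_trans sXV).
    - by rewrite -cardG_gt1 oX prime_gt1.
    by apply: contraTneq (expn_neq_prime s_pr s_pr (isT : 1 < 2)) => e; rewrite -oV -e oX eqxx.
  have [S0 ES0] : exists S0, S0 \in 'E_s^1(V) by apply/card_gt0P; rewrite cardE.
  have [sS0V _ _] := pnElemP ES0.
  have eqC : gval S0 :^: G = [set gval X | X in 'E_s^1(V)].
    apply/setP=> A; apply/imsetP/imsetP=> [[g Gg ->]|[X EX ->]]; last first.
      by apply: (nsn_conj S0 X); rewrite ?nX // (card_p1Elem ES0) (card_p1Elem EX).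
    exists (S0 :^ g)%G => //; rewrite p1ElemE // !inE /= cardJg (card_p1Elem ES0) eqxx andbT.
    by rewrite -(normsP (normal_norm nsVG) g Gg) conjSg.
  have := card_conjugates S0 G; rewrite eqC card_imset ?cardE; last exact: val_inj.
  move=> ->; rewrite -ir -ip mulnC Lagrange_index // indexgS //.
  by rewrite subsetI sVG cents_norm // centsC (subset_trans sS0V).
(* If s = 2, [R] acts nontrivially on four elements and r > 2, which forces r = 3; then p < r gives
   p = s. *)
have [s2|s_neq2] := eqVneq s 2.
  have nVR : R \subset 'N(V) := subset_trans sRG (normal_norm nsVG).
  have := card_cent_mod rR nVR; rewrite oV s2 => /eqP.
  have sC : 'C_V(R) \proper V.
    by rewrite properE subsetIl subsetI subxx /= centsC.
  have : #|'C_V(R)| %| 4 by rewrite (_ : 4 = #|V|) ?cardSg ?subsetIl // oV s2.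
  have := proper_card sC; rewrite oV s2.
  case: #|'C_V(R)| => [|[|[|[|n]]]] // _ _; rewrite eqn_mod_dvd // dvdn_prime2 //.
    move/eqP=> r3; move: lt_pr neq_ps; rewrite s2 r3; have := prime_gt1 p_pr.
    by case: (p) => [|[|[|]]].
  by rewrite gtn_eqF.
have p2 : p = 2.
  have : 2 %| r * p.
    apply: dvdn_trans dv_s1; rewrite dvdn2 /= negbK.
    by case: (even_prime s_pr) => // e; rewrite e in s_neq2.
  rewrite Euclid_dvdM // !dvdn_prime2 // => /orP[/eqP r2|/eqP//].
  by rewrite -r2 in r_gt2.
have t2 : t ^+ 2 = 1 by rewrite -p2 -ot expg_order.
have nVt : t \in 'N(V) by apply: (subsetP (normal_norm nsVG)).
have inv v : v \in V -> v ^ t = v^-1.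
  by apply: invol_inverts_abelian => //; rewrite -cent_cycle.
case/negP: ncVR.
have nVx : x \in 'N(V) by apply: (subsetP (normal_norm nsVG)); rewrite (subsetP sRG) ?cycle_id.
(* y is the product of a conjugate of [t] and [t] itself, involutions that both invert [V], so y
   centralizes [V]. It is nontrivial, hence generates [R]. *)
pose y := [~ x, t].
have Ry : y \in R by rewrite /y commgEl groupM ?groupV ?memJ_norm ?cycle_id.
have nty : y != 1.
  apply: contra ntR => /commgP cxt; rewrite -subG1 -cRP subsetI subxx /=.
  by rewrite cent_cycle cycle_subG; apply/cent1P.
rewrite -(prime_generator _ Ry nty) ?oR // cycle_subG; apply/centP=> v Vv.
apply/esym/commgP/conjg_fixP; rewrite /y commgEl conjgM.
have Vw : v ^ x^-1 \in V by rewrite memJ_norm ?groupV.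
have tV : t^-1 = t by apply/eqP; rewrite eq_invg_mul -[t * t]/(t ^+ 2) t2.
rewrite [x ^ t]conjgE tV !conjgM (inv _ Vw) conjVg conjgKV inv ?groupV ?invgK //.
Qed.

(** * The group SL_2(3) *)

(* The presentation of SL_2(3) as Q_8 extended by an element of order 3. *)
Definition quat_rel (gT : finGroupType) (i j t : gT) : Prop :=
  [/\ i ^+ 4 = 1, i ^+ 2 = j ^+ 2, i * j * i = j, t ^+ 3 = 1 & i ^ t = j /\ j ^ t = i * j].

Section QuatRel.

Variables (gT : finGroupType) (i j t : gT).
Hypothesis rel : quat_rel i j t.

Let H := (<[i]> <*> <[j]>)%G.
Let K := <<[set i; j; t]>>%G.

Lemma quat_rel_norm_i : j \in 'N(<[i]>).
Proof.
have [_ _ iji _ _] := rel; rewrite inE; apply/subsetP=> _ /imsetP[x /cycleP[n ->] ->].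
suff -> : (i ^+ n) ^ j = i^-1 ^+ n by rewrite groupX ?groupV ?cycle_id.
by rewrite conjXg; congr (_ ^+ n); apply: (mulgI j); rewrite -conjgC -{2}iji mulgK.
Qed.

Lemma quat_rel_norm_H : t \in 'N(H).
Proof.
have [_ _ _ _ [it jt]] := rel.
have [Hi Hj] : i \in H /\ j \in H.
  by split; rewrite /= mem_gen // inE cycle_id ?orbT.
rewrite inE /= -genJ gen_subG conjUg subUset -!cycleJ it jt !cycle_subG.
by rewrite Hj groupM.
Qed.

Lemma quat_rel_genE : K :=: H <*> <[t]>.
Proof.
apply/eqP; rewrite eqEsubset gen_subG !join_subG !cycle_subG.
have Hi : i \in H by rewrite /= mem_gen // inE cycle_id.
have Hj : j \in H by rewrite /= mem_gen // inE cycle_id orbT.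
apply/andP; split; last by rewrite !mem_gen // !inE eqxx ?orbT.
apply/subsetP=> x; rewrite !inE -orbA => /or3P[] /eqP->; rewrite /= mem_gen // inE.
- by rewrite Hi.
- by rewrite Hj.
by rewrite cycle_id orbT.
Qed.

(** [j] normalizes <i>, so the join is the product <i><j>. If [i] has order 4, the two factors share
    the nontrivial i^2. *)
Lemma quat_rel_card_H : #|H| <= 8.
Proof.
have [i4 ij iji t3 [it jt]] := rel.
have oj : #[j] = #[i] by rewrite -it orderJ.
have : #[i] %| 4 by rewrite order_dvdn i4.
have := mul_cardG <[i]> <[j]>; rewrite -[#|<[i]>|]/#[i] -[#|<[j]>|]/#[j] oj.
have -> : #|<[i]> * <[j]>| = #|H|.
  by rewrite /H /= norm_joinEr // cycle_subG quat_rel_norm_i.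
have i2 : i ^+ 2 \in <[i]> :&: <[j]> by rewrite inE mem_cycle ij mem_cycle.
have gt0 : 0 < #|<[i]> :&: <[j]>| := cardG_gt0 _.
case: (leqP #[i] 2) => [le2 eqH _|gt2 eqH dv4].
  have : #|H| <= #[i] * #[i] by rewrite eqH leq_pmulr.
  by move/leq_trans; apply; apply: leq_trans (leq_mul le2 le2) _.
have o4 : #[i] = 4.
  by move: gt2 dv4; case: #[i] => [|[|[|[|[|n]]]]] // _ /dvdn_leq => /(_ isT).
have : 1 < #|<[i]> :&: <[j]>|.
  rewrite cardG_gt1; apply: contraTneq i2 => ->; rewrite inE -order_dvdn o4.
  by [].
move: eqH; rewrite o4; move: #|_ :&: _| #|H|; clear => n h; nia.
Qed.

Lemma quat_rel_card_le : #|K| <= 24.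
Proof.
have [i4 ij iji t3 [it jt]] := rel.
rewrite quat_rel_genE norm_joinEr ?cycle_subG ?quat_rel_norm_H //.
have : #|H * <[t]>| <= #|H| * #[t] by rewrite mul_cardG leq_pmulr ?cardG_gt0.
move/leq_trans; apply; rewrite -[24]/(8 * 3)%N leq_mul ?quat_rel_card_H //.
by apply: dvdn_leq; rewrite // order_dvdn t3.
Qed.

(** A nontrivial i^2 gives [i] order 4, keeps [j] out of <i> (a commuting [j] would yield i^2 = 1)
    and keeps [t] nontrivial, so 8 and 3 divide the order. *)
Lemma quat_rel_card : i ^+ 2 != 1 -> #|K| = 24.
Proof.
move=> nti2; have [i4 ij iji t3 [it jt]] := rel.
have sHK : H \subset K by rewrite quat_rel_genE joing_subl.
have stK : <[t]> \subset K by rewrite quat_rel_genE joing_subr.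
have siH : <[i]> \subset H by rewrite joing_subl.
have oi : #[i] = 4.
  have : #[i] %| 4 by rewrite order_dvdn i4.
  move: nti2; rewrite -order_dvdn.
  by case: #[i] (order_gt0 i) => [|[|[|[|[|n]]]]] // _ _ /dvdn_leq => /(_ isT).
have ot : #[t] = 3.
  apply: nt_prime_order => //; apply: contraNneq nti2 => t1.
  move: it jt; rewrite t1 !conjg1 => -> /eqP; rewrite -{1}(mul1g j) eq_sym.
  by rewrite (inj_eq (mulIg j)) => /eqP->; rewrite expg1n.
have nji : j \notin <[i]>.
  apply: contra nti2 => /cycleP[n ej].
  have cij : i * j = j * i by rewrite ej -expgS -expgSr.
  apply/eqP; apply: (mulIg j); rewrite mul1g -[RHS]iji expgS expg1 -!mulgA.
  by rewrite cij.
have oH : #|H| = 8.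
  have ltH : 4 < #|H|.
    rewrite -oi; apply: proper_card; rewrite properE siH /=; apply/subsetPn; exists j => //.
    by rewrite mem_gen // inE cycle_id orbT.
  have : 4 %| #|H| by rewrite -oi cardSg.
  move: quat_rel_card_H ltH; move: #|H| => h le8 gt4.
  by do 9?[case: h le8 gt4 => [|h] //= le8 gt4]; rewrite ?ltnS in le8 gt4 *.
have dv : 24 %| #|K|.
  rewrite -[24]/(8 * 3)%N Gauss_dvd //; apply/andP; split; first by rewrite -oH cardSg.
  by rewrite -ot cardSg.
apply/eqP; rewrite eqn_leq quat_rel_card_le dvdn_leq ?cardG_gt0 //.
Qed.

End QuatRel.

(** The pairs satisfy the relations in the direct product, so they generate a group of order at most
    24; it projects onto both given groups, each of order 24. *)
Lemma quat_rel_isog (gT1 gT2 : finGroupType) (i1 j1 t1 : gT1) (i2 j2 t2 : gT2) :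
    quat_rel i1 j1 t1 -> quat_rel i2 j2 t2 -> i1 ^+ 2 != 1 -> i2 ^+ 2 != 1 ->
  <<[set i1; j1; t1]>> \isog <<[set i2; j2; t2]>>.
Proof.
move=> rel1 rel2 nt1 nt2.
pose i := (i1, i2); pose j := (j1, j2); pose t := (t1, t2).
have rel : quat_rel i j t.
  case: rel1 rel2 => [a1 b1 c1 d1 [e1 f1]] [a2 b2 c2 d2 [e2 f2]].
  have X (x : gT1) (y : gT2) n : (x, y) ^+ n = (x ^+ n, y ^+ n).
    by elim: n => // n IHn; rewrite !expgS IHn.
  split; rewrite ?X ?a1 ?a2 ?b1 ?b2 ?d1 ?d2 //.
    by rewrite /i /j; congr (_, _).
  by split; congr (_, _).
pose K := <<[set i; j; t]>>%G.
have leK : #|K| <= 24 := quat_rel_card_le rel.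
have iso1 : <<[set i1; j1; t1]>>%G \isog K.
  rewrite isogEcard (quat_rel_card rel1 nt1) leK andbT.
  have defK : fst @* K = <<[set i1; j1; t1]>>.
    by rewrite morphim_gen ?subsetT // morphimEsub ?subsetT // !imsetU !imset_set1.
  by rewrite /= -defK; apply: morphim_homg; apply: subsetT.
have iso2 : <<[set i2; j2; t2]>>%G \isog K.
  rewrite isogEcard (quat_rel_card rel2 nt2) leK andbT.
  have defK : snd @* K = <<[set i2; j2; t2]>>.
    by rewrite morphim_gen ?subsetT // morphimEsub ?subsetT // !imsetU !imset_set1.
  by rewrite /= -defK; apply: morphim_homg; apply: subsetT.
by apply: isog_trans iso1 _; rewrite isog_sym.
Qed.

(** * Matrix generators of SL_2(3) *)

Section SL23Generators.

Import GRing.Theory.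
Local Open Scope ring_scope.

Definition mx22 (a b c d : 'F_3) : 'M['F_3]_2 :=
  \matrix_(i < 2, j < 2)
    if i == 0 then if j == 0 then a else b else if j == 0 then c else d.

Lemma mul_mx22 a b c d a' b' c' d' :
  mx22 a b c d * mx22 a' b' c' d' =
  mx22 (a * a' + b * c') (a * b' + b * d') (c * a' + d * c') (c * b' + d * d').
Proof.
apply/matrixP=> i j; rewrite !mxE !big_ord_recl big_ord0 addr0 !mxE /=.
by case: (i == 0); case: (j == 0).
Qed.

Lemma mx22_1 : mx22 1 0 0 1 = 1.
Proof.
apply/matrixP=> i j; rewrite !mxE.
by case: i => [[|[|]]] //= ?; case: j => [[|[|]]] //= ?.
Qed.

(** [MI] and [MJ] generate the quaternion Sylow 2-subgroup; [MT] is a transvection, of order 3, and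
    [MJ] is the conjugate of [MI] by [MT]. *)
Let MI := mx22 0 1 (-1) 0.
Let MJ := mx22 1 (-1) (-1) (-1).
Let MT := mx22 1 1 0 1.

Lemma eq_mx22 a b c d a' b' c' d' :
  [&& a == a', b == b', c == c' & d == d'] -> mx22 a b c d = mx22 a' b' c' d'.
Proof. by case/and4P=> /eqP-> /eqP-> /eqP-> /eqP->. Qed.

Let MI4 : MI * MI * MI * MI = 1.
Proof. by rewrite !mul_mx22 -mx22_1; apply: eq_mx22; vm_compute. Qed.
Let MJ4 : MJ * MJ * MJ * MJ = 1.
Proof. by rewrite !mul_mx22 -mx22_1; apply: eq_mx22; vm_compute. Qed.
Let MI2 : MI * MI = MJ * MJ.
Proof. by rewrite !mul_mx22; apply: eq_mx22; vm_compute. Qed.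
Let MIJI : MI * MJ * MI = MJ.
Proof. by rewrite !mul_mx22; apply: eq_mx22; vm_compute. Qed.
Let MT3 : MT * MT * MT = 1.
Proof. by rewrite !mul_mx22 -mx22_1; apply: eq_mx22; vm_compute. Qed.
Let MIT : MI * MT = MT * MJ.
Proof. by rewrite !mul_mx22; apply: eq_mx22; vm_compute. Qed.
Let MJT : MJ * MT = MT * (MI * MJ).
Proof. by rewrite !mul_mx22; apply: eq_mx22; vm_compute. Qed.
Let MI2n1 : MI * MI != 1.
Proof.
rewrite !mul_mx22 -mx22_1; apply/eqP=> /matrixP/(_ 0 0); rewrite !mxE /=.
by move/eqP; vm_compute.
Qed.

Lemma SL23_quat_rel :
  exists i j t : {'GL_2['F_3]}, quat_rel i j t /\ (i ^+ 2 != 1)%g.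
Proof.
have uI : MI \is a GRing.unit.
  apply/unitrP; exists (MI * MI * MI); split; last by rewrite !mulrA.
  exact: MI4.
have uT : MT \is a GRing.unit.
  by apply/unitrP; exists (MT * MT); split; [exact: MT3 | rewrite mulrA MT3].
have uJ : MJ \is a GRing.unit.
  apply/unitrP; exists (MJ * MJ * MJ); split; last by rewrite !mulrA.
  exact: MJ4.
pose gI : {'GL_2['F_3]} := FinRing.unit _ uI.
pose gJ : {'GL_2['F_3]} := FinRing.unit _ uJ.
pose gT : {'GL_2['F_3]} := FinRing.unit _ uT.
exists gI, gJ, gT.
have cj (x y z : {'GL_2['F_3]}) : (x * y = y * z)%g -> (x ^ y = z)%g.
  by move=> e; rewrite conjgE e mulKg.
split; first split.
- by apply: val_inj; rewrite /= -[RHS]MI4 -!mulrA.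
- by apply: val_inj; exact: MI2.
- by apply: val_inj; exact: MIJI.
- by apply: val_inj; rewrite /= -[RHS]MT3 -!mulrA.
- by split; apply: cj; apply: val_inj; [exact: MIT | exact: MJT].
by rewrite -val_eqE; exact: MI2n1.
Qed.

End SL23Generators.

Lemma SL23_group_set : group_set SL23.
Proof.
apply/group_setP; split=> [|x y]; rewrite !inE ?det1 // GL_MxE det_mulmx.
by move=> /eqP-> /eqP->; rewrite GRing.mulr1.
Qed.
Canonical SL23_group := Group SL23_group_set.

Lemma cube_F3 (x : 'F_3) : (x ^+ 3 = 1 -> x = 1)%R.
Proof. by move=> e; apply/eqP; move/eqP: e; case: x => [[|[|[|]]]]. Qed.

(** GL_2(3) has order 48 and contains diag(-1, 1), of determinant -1, so the index is at least 2. *)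
Lemma SL23_card : #|SL23| <= 24.
Proof.
have oGL : #|'GL_2['F_3]| = 48 by rewrite card_GL_2 card_Fp.
have sSL : SL23 \subset 'GL_2['F_3] by apply: subsetT.
pose d : 'rV['F_3]_2 := (\row_j if j == 0 then -1 else 1)%R.
have detD : (\det (diag_mx d) = -1)%R.
  by rewrite det_diag !big_ord_recl big_ord0 !mxE /= GRing.mul1r GRing.mulr1.
have uD : (diag_mx d \is a GRing.unit)%R by rewrite -[_ \is a _]/(_ \in unitmx) unitmxE detD.
have i_gt1 : 1 < #|'GL_2['F_3] : SL23|.
  rewrite indexg_gt1; apply/subsetPn; exists (FinRing.unit _ uD : {'GL_2['F_3]}) => //.
  by rewrite inE /= detD.
by rewrite -(@leq_pmul2r 2) // -[(24 * 2)%N]oGL -(Lagrange sSL) leq_pmul2l.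
Qed.

(** The relations force determinant 1: i, j and i j are conjugate, and 1 is the only element of F_3
    with cube 1. *)
Lemma quat_rel_isog_SL23 (gT : finGroupType) (i j t : gT) :
  quat_rel i j t -> i ^+ 2 != 1 -> <<[set i; j; t]>> \isog SL23.
Proof.
move=> rel nti; have [i' [j' [t' [rel' nti']]]] := SL23_quat_rel.
suff <- : <<[set i'; j'; t']>> = SL23 by apply: quat_rel_isog.
have dM (x y : {'GL_2['F_3]}) : (\det (GLval (x * y)%g) = \det (GLval x) * \det (GLval y))%R.
  by rewrite GL_MxE det_mulmx.
have dJ (x y : {'GL_2['F_3]}) : (\det (GLval (x ^ y)%g) = \det (GLval x))%R.
  by rewrite conjgE !dM GL_VxE det_inv GRing.mulrCA GRing.mulVf ?GL_det // GRing.mulr1.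
have [i4 ij iji t3 [it jt]] := rel'.
apply/eqP; rewrite eqEcard (leq_trans SL23_card) ?(quat_rel_card rel' nti') // andbT.
rewrite gen_subG; apply/subsetP.
have dj : (\det (GLval j') = \det (GLval i'))%R by rewrite -it dJ.
have di : (\det (GLval i') = 1)%R.
  have := dJ j' t'; rewrite jt dM dj -{3}[(\det i')%R]GRing.mul1r.
  by apply: GRing.mulIf; apply: GL_det.
have dt : (\det (GLval t') = 1)%R.
  apply: cube_F3; have := congr1 (fun x : {'GL_2['F_3]} => (\det (GLval x))%R) t3.
  by rewrite !expgS expg0 mulg1 !dM GL_1E det1 !GRing.exprS GRing.expr0 GRing.mulr1.
move=> x; rewrite !inE -orbA => /or3P[] /eqP->; rewrite ?dj ?di ?dt //.
Qed.

(** * Extensions of nonabelian groups of order s^3 *)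

Lemma nonabelian_p3_max (gT : finGroupType) (N B : {group gT}) (s : nat) :
    prime s -> #|N| = (s ^ 3)%N -> B \subset N -> #|B| = (s ^ 2)%N ->
  B <| N /\ N^`(1) \subset B.
Proof.
move=> s_pr oN sBN oB; have sN : s.-group N by rewrite /pgroup oN pnatX pnat_id.
have iB : #|N : B| = s.
  apply/eqP; rewrite -(eqn_pmul2l (cardG_gt0 B)) Lagrange // oN oB.
  by rewrite -expnSr.
have nsBN : B <| N.
  by apply: p_maximal_normal sN _; apply: p_index_maximal; rewrite // iB.
split=> //; apply: der1_min; first exact: normal_norm.
apply: cyclic_abelian; apply: prime_cyclic; rewrite card_quotient ?iB //.
exact: normal_norm.
Qed.

(** Subgroups of order s^2 contain N', and distinct ones meet exactly in N'. They cut the rest of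
    [N] into blocks of s^2 - s elements, so there are (s^3 - s)/(s^2 - s) of them. *)
Lemma card_nonabelian_p3_max (gT : finGroupType) (N : {group gT}) (s : nat) :
    prime s -> #|N| = (s ^ 3)%N -> #|N^`(1)| = s ->
  #|[set B : {group gT} | (B \subset N) && (#|B| == s ^ 2)%N]| = s.+1.
Proof.
move=> s_pr oN oZ; set L := [set _ | _].
have s_gt1 := prime_gt1 s_pr; have s_gt0 := prime_gt0 s_pr.
have sN : s.-group N by rewrite /pgroup oN pnatX pnat_id.
have ncN : ~~ cyclic N.
  apply: contraL s_pr => /cyclic_abelian/derG1P e; by rewrite -oZ e cards1.
have inL (B : {group gT}) : B \in L -> [/\ B \subset N, #|B| = (s ^ 2)%N & N^`(1) \subset B].
  rewrite inE => /andP[sBN /eqP oB].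
  by have [_ sZB] := nonabelian_p3_max s_pr oN sBN oB.
have sZN : N^`(1) \subset N := der_sub 1 N.
have ex1 x : x \in N :\: N^`(1) -> #|[set B in L | x \in B]| = 1%N.
  case/setDP=> Nx nZx; have [M [nsM iM Mx]] := pgroup_max_cover sN ncN Nx.
  have LM : M \in L.
    rewrite inE normal_sub //= -(eqn_pmul2r s_gt0) -{1}iM Lagrange ?normal_sub // oN.
    by rewrite -expnSr.
  apply/eqP/cards1P; exists M; apply/setP=> B; rewrite in_set1.
  apply/setIdP/eqP=> [[LB Bx]|-> //].
  have [sMN oM sZM] := inL M LM; have [sBN oB sZB] := inL B LB.
  have sZI : N^`(1) \proper B :&: M.
    rewrite properE subsetI sZB sZM /=; apply/subsetPn; exists x => //.
    by rewrite inE Bx.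
  have : #|B :&: M| %| s ^ 2 by rewrite -oB cardSg ?subsetIl.
  have := proper_card sZI; rewrite oZ => lts.
  case/dvdn_pfactor=> // k le_k2 oI.
  have k2 : k = 2.
    by move: lts; rewrite oI -{1}(expn1 s) ltn_exp2l //; case: k le_k2 {oI} => [|[|[|]]].
  rewrite k2 in oI; apply/val_inj/eqP; rewrite /= eqEcard oB oM leqnn andbT.
  apply/setIidPl/eqP; rewrite eqEcard subsetIl oI oB leqnn //.
have : #|N :\: N^`(1)| = (#|L| * (s ^ 2 - s))%N.
  rewrite -sum1_card.
  transitivity (\sum_(x in N :\: N^`(1)) \sum_(B in L | x \in B) 1)%N.
    apply: eq_bigr => x Dx; rewrite -[LHS](ex1 x Dx) -sum1_card.
    by apply: eq_bigl => B; rewrite in_set.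
  rewrite (exchange_big_dep (mem L)) /=; last by move=> x B _ /andP[].
  rewrite -sum_nat_const; apply: eq_bigr => B LB; have [sBN oB sZB] := inL B LB.
  have -> : (s ^ 2 - s = #|B :\: N^`(1)|)%N by rewrite cardsD (setIidPr sZB) oB oZ.
  rewrite -sum1_card; apply: eq_bigl => x; rewrite LB !inE.
  by case Bx: (x \in B); rewrite ?andbF // (subsetP sBN) ?andbT.
rewrite cardsD (setIidPr sZN) oN oZ; move: #|L| => m.
case: s s_gt1 {oN oZ L inL ex1 sN s_pr s_gt0} => [|[|k]] // _.
move=> e; apply/eqP; rewrite -(@eqn_pmul2r (k.+2 ^ 2 - k.+2)).
  rewrite -e; apply/eqP; clear; nia.
by clear; nia.
Qed.

(** The map sending x to x^-1 x^t is injective on [N], hence onto, and [t] inverts each of its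
    values. Inversion is thus multiplicative on [N]. *)
Lemma fixfree_invol_abelian (gT : finGroupType) (N : {group gT}) t :
  t ^+ 2 = 1 -> t \in 'N(N) -> 'C_N[t] = 1 -> abelian N.
Proof.
move=> t2 nNt cNt; pose f x := x^-1 * x ^ t.
have injf : {in N &, injective f}.
  move=> x y Nx Ny /eqP; rewrite /f eq_sym => /eqP e.
  have : x * y^-1 \in 'C_N[t].
    rewrite inE groupM ?groupV //=; apply/cent1P/commgP/conjg_fixP.
    rewrite conjMg conjVg; apply: (mulIg (y ^ t)); rewrite mulgKV.
    by rewrite -mulgA e mulKVg.
  by rewrite cNt => /set1P/eqP; rewrite -eq_mulgV1 => /eqP.
have sfN : f @: N \subset N.
  by apply/subsetP=> _ /imsetP[x Nx ->]; rewrite groupM ?groupV ?memJ_norm.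
have fN : f @: N = N by apply/eqP; rewrite eqEcard sfN (card_in_imset injf) leqnn.
have inv y : y \in N -> y ^ t = y^-1.
  rewrite -{1}fN => /imsetP[x Nx ->].
  by rewrite /f conjMg conjVg -conjgM -[t * t]/(t ^+ 2) t2 conjg1 [RHS]invMg invgK.
apply/centsP=> x Nx y Ny; apply: invg_inj; rewrite -inv ?groupM // conjMg !inv //.
by rewrite invMg.
Qed.

Lemma four_extraspecial_der1 (gT : finGroupType) (G : {group gT}) (s p : nat) :
    Dcount G = 4 -> prime s -> prime p ->
    #|G^`(2)| = s -> #|G^`(1)| = (s ^ 3)%N -> #|G : G^`(1)| = p ->
  [/\ #|G| = 24, #|G^`(1)| = 8, #|G^`(2)| = 2,
      forall x, x \in G^`(1) -> x ^+ 2 = 1 -> x \in G^`(2)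
    & exists t, [/\ t \in G, t ^+ 3 = 1
        & forall B : {group gT}, B \subset G^`(1) -> #|B| = 4 -> t \notin 'N(B)]].
Proof.
move=> D4 s_pr p_pr oZ oN ip.
pose N := G^`(1)%G; pose Z := G^`(2)%G.
have sNG : N \subset G := der_sub 1 G.
have sZN : Z \subset N := der_sub 1 _.
have nsNG : N <| G := der_normal 1 G.
have nsZG : Z <| G := der_normal 2 G.
have sZG := subset_trans sZN sNG.
have s_gt1 := prime_gt1 s_pr.
have ntZ : Z :!=: 1 by rewrite -cardG_gt1 oZ.
have ntN : N :!=: 1 by apply: contra ntZ => /eqP e; rewrite -subG1 -e.
have sN : s.-group N by rewrite /pgroup oN pnatX pnat_id.
have ncN : ~~ abelian N by apply: contra ntZ => /derG1P e; apply/eqP.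
have oG : #|G| = (s ^ 3 * p)%N by rewrite -(Lagrange sNG) oN ip.
have neqNG : N :!=: G.
  by apply: contraTneq p_pr => e; rewrite -ip -[G^`(1)]/(gval N) e indexgg.
have neqZN : Z :!=: N by apply: contraNneq ncN => e; apply: cyclic_abelian; rewrite -e prime_cyclic ?oZ.
have neq_ps : p != s.
  apply: contra ncN => /eqP eps; apply: (abelianS sNG); apply: cyclic_abelian.
  apply: cyclic_nilpotent_quo_der1_cyclic.
    by apply: (@pgroup_nil _ s); rewrite /pgroup oG eps -expnSr pnatX pnat_id.
  by apply: prime_cyclic; rewrite card_quotient ?der_norm // ip.
pose L := [set B : {group gT} | (B \subset N) && (#|B| == s ^ 2)%N].
have cardL : #|L| = s.+1 by apply: card_nonabelian_p3_max.
have inL (B : {group gT}) : B \in L -> B \subset N /\ #|B| = (s ^ 2)%N.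
  by rewrite inE => /andP[-> /eqP].
have nsB (B : {group gT}) : B \in L -> B <| N.
  by case/inL=> sB oB; have [] := nonabelian_p3_max s_pr oN sB oB.
have nB (B : {group gT}) : B \in L -> gval B \in nsn_subgroups G.
  move=> LB; have [sB oB] := inL B LB; apply: (nsn_normal (nsB B LB)) => //.
    by rewrite -cardG_gt1 oB (ltn_exp2l 0).
  apply/eqP=> /(congr1 (fun A : {set gT} => #|A|)); rewrite oB oN => /eqP.
  by rewrite eqn_exp2l.
have nZ : gval Z \in nsn_subgroups G by apply: (nsn_normal (K := N) _ sNG ntZ neqZN); apply: (der_normal 1).
have nN : gval N \in nsn_subgroups G by apply: nsn_normal nsNG _ ntN neqNG.
have classB (B : {group gT}) : B \in L -> #|gval B :^: G| %| p.
  move=> LB; rewrite card_conjugates -ip; apply: indexgS.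
  by rewrite subsetI sNG normal_norm ?nsB.
have [t Gt ot] : {t | t \in G & #[t] = p} by apply: Cauchy; rewrite // oG dvdn_mull.
pose P := <[t]>%G; have oP : #|P| = p by [].
have sPG : P \subset G by rewrite cycle_subG.
have ntP : P :!=: 1 by rewrite -cardG_gt1 oP prime_gt1.
have pP : p.-group P by rewrite /pgroup oP pnat_id.
have [B0 LB0] : exists B, B \in L by apply/card_gt0P; rewrite cardL.
(* If [P] is nsn, the orders s, p, s^2, s^3 exhaust the list. The s + 1 subgroups of order s^2 form
   one class, of size dividing p, so p = s + 1 and parity gives s = 2. *)
have [nP|nnP] := eqVneq 'N_G(P) P; last first.
  have nP : gval P \in nsn_subgroups G by rewrite nsnE sPG ntP.
  pose l := [:: s; p; s ^ 2; s ^ 3]%N.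
  have uniq_l : uniq l.
    rewrite /l /= !inE !negb_or (eq_sym s p) neq_ps (eq_sym s (s ^ 2)%N).
    rewrite (eq_sym s (s ^ 3)%N) (eq_sym p (s ^ 2)%N) (eq_sym p (s ^ 3)%N).
    by rewrite eqn_exp2l // !expn_neq_prime.
  have all_l : all (nsn_order G) l.
    have [_ oB0] := inL _ LB0.
    rewrite /= andbT; apply/and4P; split; apply/nsn_orderP.
    - by exists Z.
    - by exists P.
    - by exists B0; rewrite ?nB.
    by exists N.
  have [_ nsn_in nsn_conj] := nsn_order_exhaust uniq_l all_l (eq_leq D4).
  have cardC (B : {group gT}) : B \in L -> #|gval B :^: G| = s.+1.
    move=> LB; suff -> : gval B :^: G = [set gval B1 | B1 in L].
      by rewrite card_imset ?cardL //; apply: val_inj.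
    have [sB oB] := inL _ LB.
    apply/setP=> A; apply/imsetP/imsetP=> [[g Gg ->]|[B1 LB1 ->]]; last first.
      by have [_ oB1] := inL _ LB1; apply: (nsn_conj B B1); rewrite ?nB // oB oB1.
    exists (B :^ g)%G => //; rewrite inE /= cardJg oB eqxx andbT.
    by rewrite -(normsP (normal_norm nsNG) g Gg) conjSg.
  have eps : s.+1 = p.
    have := classB _ LB0; rewrite cardC //; case/primeP: p_pr => _ /[apply].
    by rewrite eqSS (gtn_eqF (prime_gt0 s_pr)) => /eqP.
  have s2 : s = 2.
    case: (even_prime s_pr) => // odd_s; have : ~~ odd p by rewrite -eps /= odd_s.
    by case: (even_prime p_pr) => [p2|-> //]; move: s_gt1; rewrite -ltnS eps p2.
  have p3 : p = 3 by rewrite -eps s2.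
  split; rewrite ?oG ?oN ?oZ ?s2 ?p3 //.
    move=> x Nx x2; have [->|ntx] := eqVneq x 1; first exact: group1.
    have ox : #|<[x]>| = s by rewrite -[#|_|]/#[x] s2; apply: nt_prime_order.
    have sxN : <[x]> \subset N by rewrite cycle_subG.
    have nx : gval <[x]>%G \in nsn_subgroups G.
      apply: (@nsn_not_Sylow _ G <[x]>%G s); rewrite /= ?(pgroupS sxN) ?cycle_eq1 //.
        exact: subset_trans sNG.
      rewrite pHallE ox oG p_part lognM ?expn_gt0 ?prime_gt0 // pfactorK //.
      by rewrite -{1}(expn1 s) eqn_exp2l // addSn andbF.
    have [g Gg eqx] := nsn_conj Z <[x]>%G nZ nx (etrans oZ (esym ox)).
    by rewrite -[G^`(2)]/(gval Z) -(normsP (normal_norm nsZG) g Gg) -eqx cycle_id.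
  exists t; split=> //; first by rewrite -p3 -ot expg_order.
  (* The class of [B] has size p = 3; if [t] normalized [B], 3 would divide |G : P| = 8. *)
  move=> B sBN oB; apply/negP=> nBt.
  have LB : B \in L by rewrite inE sBN oB s2.
  have : #|G : 'N_G(B)| %| #|G : P|.
    by apply: indexgS; rewrite subsetI sPG cycle_subG.
  rewrite -card_conjugates cardC // eps -divgS // oG oP mulnK ?prime_gt0 //.
  by rewrite Euclid_dvdX // dvdn_prime2 // (negPf neq_ps).
exfalso.
have coNP : coprime #|N| #|P|.
  by rewrite oN oP coprime_pexpl // prime_coprime // dvdn_prime2 // eq_sym.
have cNP : 'C_N(P) = 1 by apply: (self_norm_cent_trivial nP).
have cZP : 'C_Z(P) = 1 by apply/trivgP; rewrite -cNP setSI.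
have dv_ps : p %| s - 1.
  have nZP : P \subset 'N(Z) := subset_trans sPG (normal_norm nsZG).
  have := card_cent_mod pP nZP; rewrite cZP cards1 oZ => /eqP.
  by rewrite eqn_mod_dvd // ltnW.
(* [Z] and [N] take two of the four classes; at most two classes, each of size at most p, remain for
   the s + 1 subgroups of order s^2. *)
have le_s2p : s.+1 <= p * 2.
  pose CL := [set gval B :^: G | B in L].
  have notCL (X : {group gT}) : #|X| != (s ^ 2)%N -> gval X :^: G \notin CL.
    apply: contra => /imsetP[B /inL[_ oB] /(congr1 (@class_order gT))].
    by rewrite !class_orderE oB => ->.
  have : gval Z :^: G |: (gval N :^: G |: CL) \subset [set H :^: G | H in nsn_subgroups G].
    have memC (X : {group gT}) : gval X \in nsn_subgroups G ->
        gval X :^: G \in [set H :^: G | H in nsn_subgroups G].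
      exact: (imset_f (fun H : {set gT} => H :^: G)).
    rewrite !subUset !sub1set !memC //; apply/subsetP=> _ /imsetP[B LB ->].
    by rewrite memC ?nB.
  move/subset_leq_card; rewrite -/(Dcount G) D4 !cardsU1 !inE negb_or.
  rewrite !notCL ?oZ ?oN; last 2 first.
  - by rewrite eqn_exp2l.
  - by rewrite eq_sym expn_neq_prime.
  have -> : (gval Z :^: G != gval N :^: G).
    apply/eqP=> /(congr1 (@class_order gT)); rewrite !class_orderE oZ oN => /esym/eqP.
    by rewrite (negPf (expn_neq_prime _ _ _)).
  rewrite /= !add1n !ltnS => leCL.
  have sL : [set gval B | B in L] \subset cover CL.
    apply/subsetP=> _ /imsetP[B LB ->]; apply/bigcupP; exists (gval B :^: G).
      exact: (imset_f (fun B : {group gT} => gval B :^: G)).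
    exact: (orbit_refl 'Js).
  have := subset_leq_card sL; rewrite card_imset ?cardL; last exact: val_inj.
  move/leq_trans; apply; apply: leq_trans (leq_card_cover CL) _.
  apply: leq_trans (_ : \sum_(C in CL) p <= _)%N; last first.
    by rewrite sum_nat_const mulnC leq_mul2l leCL orbT.
  apply: leq_sum => _ /imsetP[B LB ->].
  by apply: dvdn_leq; rewrite ?prime_gt0 ?classB.
(* p divides s - 1 and s + 1 is at most 2p, so s = p + 1, and parity gives p = 2. *)
have p2 : p = 2.
  have eps : s = p.+1.
    case/dvdnP: dv_ps => k ek; clear -ek le_s2p s_gt1; case: k ek => [|[|k]]; nia.
  case: (even_prime p_pr) => // odd_p.
  case: (even_prime s_pr) => [s2|]; last by rewrite eps /= odd_p.
  by move: (prime_gt1 p_pr); rewrite -ltnS -eps s2.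
case/negP: ncN; apply: (@fixfree_invol_abelian _ _ t).
- by rewrite -p2 -ot expg_order.
- by apply: (subsetP (normal_norm nsNG)).
by rewrite -cent_cycle.
Qed.

(** Take any [i] outside N' and j = i^t. [N] is the union of <i> and <i>j, and j^t lies in neither
    <i> nor <j>, so it is i j or i^-1 j. The pair (i, j) serves in the first case, the pair of
    inverses in the second. *)
Lemma quaternion_ext_quat_rel (gT : finGroupType) (N : {group gT}) t :
    #|N| = 8 -> #|N^`(1)| = 2 ->
    (forall x, x \in N -> x ^+ 2 = 1 -> x \in N^`(1)) ->
    t \in 'N(N) -> t ^+ 3 = 1 ->
    (forall B : {group gT}, B \subset N -> #|B| = 4 -> t \notin 'N(B)) ->
  exists i j, [/\ i \in N, j \in N, quat_rel i j t & i ^+ 2 != 1].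
Proof.
move=> oN oZ invZ nNt t3 nBt.
have sZN : N^`(1) \subset N := der_sub 1 N.
have ncN : ~~ abelian N.
  by apply/negP=> /derG1P e; rewrite e cards1 in oZ.
have uniqZ u v : u \in N^`(1) -> v \in N^`(1) -> u != 1 -> v != 1 -> u = v.
  move=> Zu Zv ntu ntv; have defu : <[u]> = N^`(1) by apply: prime_generator; rewrite ?oZ.
  have ou : #[u] = 2 by rewrite -[#[u]]/#|<[u]>| defu.
  by move: Zv; rewrite -defu cycle2g // !inE (negPf ntv) => /eqP.
have exp4 x : x \in N -> x ^+ 4 = 1.
  move=> Nx; have : #[x] %| 2 ^ 3 by rewrite -[(2 ^ 3)%N]oN order_dvdG.
  case/dvdn_pfactor=> // k le_k3 ox; apply/eqP; rewrite -order_dvdn ox.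
  case: k le_k3 ox => [|[|[|[|k]]]] // _ ox.
  case/negP: ncN; suff <- : <[x]> = N by apply: cycle_abelian.
  by apply/eqP; rewrite eqEcard cycle_subG Nx oN -[#|<[x]>|]/#[x] ox.
have sqZ x : x \in N -> x ^+ 2 \in N^`(1).
  by move=> Nx; apply: invZ; rewrite ?groupX // -expgM exp4.
have ord4 x : x \in N -> x ^+ 2 != 1 -> #|<[x]>| = 4.
  move=> Nx; rewrite -order_dvdn -[#|_|]/#[x]; have : #[x] %| 4 by rewrite order_dvdn exp4.
  by case: #[x] (order_gt0 x) => [|[|[|[|[|n]]]]] // _ /dvdn_leq => /(_ isT).
have [i Ni nZi] : exists2 i, i \in N & i \notin N^`(1).
  by apply/subsetPn; apply/negP=> /subset_leq_card; rewrite oN oZ.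
have nti2 : i ^+ 2 != 1 by apply: contra nZi => /eqP; apply: invZ.
pose j := i ^ t; have Nj : j \in N by rewrite memJ_norm.
have ntj2 : j ^+ 2 != 1 by rewrite -conjXg conjg_eq1.
have ij2 : i ^+ 2 = j ^+ 2 by apply: uniqZ; rewrite ?sqZ.
have oi := ord4 i Ni nti2; have oj := ord4 j Nj ntj2.
have siN : <[i]> \subset N by rewrite cycle_subG.
have sjN : <[j]> \subset N by rewrite cycle_subG.
have nti : t \notin 'N(<[i]>) := nBt <[i]>%G siN oi.
have ntj : t \notin 'N(<[j]>) := nBt <[j]>%G sjN oj.
have nij : j \notin <[i]>.
  by apply: contra nti => ij; rewrite inE -cycleJ cycle_subG.
have [cij|cij] := eqVneq [~ i, j] 1.
  case/negP: ncN; suff <- : <[i]> <*> <[j]> = N.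
    rewrite abelianY !cycle_abelian /= cent_cycle cycle_subG; apply/cent1P.
    exact/esym/commgP/eqP.
  have sH : <[i]> <*> <[j]> \subset N by rewrite join_subG siN.
  apply/eqP; rewrite eqEcard sH oN /=.
  have prH : <[i]> \proper <[i]> <*> <[j]>.
    rewrite properE joing_subl; apply/subsetPn; exists j => //.
    by rewrite mem_gen // inE cycle_id orbT.
  have := proper_card prH; rewrite oi; have := cardSg sH; rewrite oN.
  by move: #|_ <*> _|; do 8?[case=> //].
have Zc : [~ i, j] \in N^`(1) by apply: mem_commg.
have eqc : [~ i, j] = i ^+ 2 by apply: uniqZ; rewrite ?sqZ.
have iji : i * j * i = j.
  rewrite [i * j]conjgC -mulgA -[RHS]mulg1; congr (_ * _).
  have -> : i ^ j = i * [~ i, j] by rewrite commgEl mulKVg.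
  by rewrite eqc -expgS -expgSr exp4.
pose k := j ^ t; have Nk : k \in N by rewrite memJ_norm.
(* Otherwise t^2, which is t^-1, would normalize <i>, and so would [t]. *)
have nki : k \notin <[i]>.
  apply: contra nti => ik.
  have ek : <[i]> :^ (t * t) = <[i]>.
    apply/eqP; rewrite eqEcard cardJg leqnn andbT conjsgM -!cycleJ cycle_subG.
    exact: ik.
  by rewrite -groupV (_ : t^-1 = t * t) ?inE ?ek //; apply/eqP; rewrite eq_invg_mul -t3.
have nkj : k \notin <[j]>.
  by apply: contra ntj => jk; rewrite inE -cycleJ cycle_subG.
have defN : <[i]> :|: <[i]> :* j = N.
  apply/eqP; rewrite eqEcard subUset siN mul_subG ?sub1set //= oN cardsU card_rcoset oi.
  rewrite (_ : _ :&: _ = set0) ?cards0 //; apply/setP=> x; rewrite !inE.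
  apply/negbTE/negP=> /andP[ix /rcosetP[y iy ex]]; case/negP: nij.
  by rewrite -(groupMl j iy) -ex.
have : k \in <[i]> :* j by move: Nk; rewrite -defN inE (negPf nki).
case/rcosetP=> y /cyclePmin[a]; rewrite -[#[i]]/#|<[i]>| oi => lta -> ek.
have i4 := exp4 i Ni.
have iV : i ^+ 3 = i^-1 by apply/eqP; rewrite eq_sym eq_invg_mul -expgS i4.
case: a lta ek => [|[|[|[|a]]]] // _ ek.
- by case/negP: nkj; rewrite ek mul1g cycle_id.
- by exists i, j; split=> //; split=> //; split=> //; rewrite -[LHS]/k ek expg1.
- by case/negP: nkj; rewrite ek ij2 -expgSr mem_cycle.
exists i^-1, j^-1; rewrite !groupV expgVn invg_eq1; split=> //; split.
- by rewrite expgVn i4 invg1.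
- by rewrite !expgVn ij2.
- by rewrite -[in RHS]iji (invMg (i * j) i) (invMg i j) mulgA.
- exact: t3.
split; first by rewrite conjVg.
rewrite conjVg -/k ek iV (invMg i^-1 j) invgK; apply: (mulgI i); rewrite mulKVg.
apply: invg_inj; rewrite (invMg i (j^-1 * i)) (invMg j^-1 i) !invgK -{1}iji.
by rewrite -!mulgA mulgV mulg1 mulKg.
Qed.

Theorem mainTheorem19 (gT : finGroupType) (G : {group gT}) :
  Dcount G = 4 -> ~ (G \isog A5) ->
  solvable G /\ (G^`(2) = 1 \/ G \isog SL23).
Proof.
move=> D4 nA5; have solG : solvable G.
  by apply: contraT => nsG; case: nA5; apply: nonsol_isog_A5.
split=> //; have [->|nt2] := eqVneq G^`(2) 1; first by left.
right; have := sol_bigomega_le5 D4 solG; rewrite leq_eqVlt ltnS => /predU1P[om5|om4].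
  by case/eqP: nt2; apply: sol_bigomega5.
case: (sol_der2_structure solG om4 nt2) => [[s [p [s_pr p_pr oZ oN ip]]]|]; last first.
  case=> s [r [p [[s_pr r_pr p_pr] oV ir ip [cV ncV]]]].
  by case: (four_no_rank2_der2 D4 s_pr r_pr p_pr oV ir ip cV ncV).
have [oG oN8 oZ2 invZ [t [Gt t3 nBt]]] := four_extraspecial_der1 D4 s_pr p_pr oZ oN ip.
have nNt : t \in 'N(G^`(1)) by apply: (subsetP (der_norm 1 G)).
have [i [j [Ni Nj rel nti]]] := quaternion_ext_quat_rel (N := G^`(1)%G) oN8 oZ2 invZ nNt t3 nBt.
have sNG := subsetP (der_sub 1 G).
suff -> : gval G = <<[set i; j; t]>> by apply: quat_rel_isog_SL23.
apply/esym/eqP; rewrite eqEcard (quat_rel_card rel nti) oG leqnn andbT gen_subG.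
apply/subsetP=> x; rewrite !inE -orbA => /or3P[] /eqP->; last exact: Gt.
  exact: sNG.
exact: sNG.
Qed.
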